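(* Let $d,n$ be positive integers and let $A$ and $B$ be measurable sets of finite positive measure in $\mathbb{R}^d$. Let $A'$ and $B'$ be (Euclidean) balls in $\mathbb{R}^d$ with $|A'|=|A|$ and $|B'|=|B|$. Let $b_1,\dots,b_n$ be chosen independently and uniformly at random from $B$, and let $b'_1,\dots,b'_n$ be chosen independently and uniformly at random from $B'$. Then $$\mathbb{E}\Big(\Big|\bigcup_{i=1}^n(A+b_i)\Big|\Big)\ \ge\ \mathbb{E}\Big(\Big|\bigcup_{i=1}^n(A'+b'_i)\Big|\Big).$$
   Context: $|\cdot|$ denotes Lebesgue measure on $\mathbb{R}^d$, and $A+b=\{a+b: a\in A\}$. *)

(* Defs.v *)
From mathcomp Require Export all_boot all_order all_algebra.
From mathcomp Require Export all_classical all_reals all_analysis.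

Set Implicit Arguments.
Unset Strict Implicit.
Unset Printing Implicit Defensive.

Import Order.TTheory GRing.Theory Num.Theory.
Import numFieldNormedType.Exports.

Local Open Scope classical_set_scope.
Local Open Scope ring_scope.

(* A point of R^d is a row vector x : 'rV[R]_d, with coordinates x 0 i. *)

Definition box (R : realType) (d : nat) (a b : 'rV[R]_d) : set 'rV[R]_d :=
  [set x | forall i, a 0 i < x 0 i <= b 0 i].

Definition box_cover (R : realType) (d : nat) (X : set 'rV[R]_d) :
    set (nat -> 'rV[R]_d * 'rV[R]_d) :=
  [set c : nat -> 'rV[R]_d * 'rV[R]_d |
           (forall k i, (c k).1 0 i <= (c k).2 0 i) /\
           X `<=` \bigcup_k box (c k).1 (c k).2].

(* Lebesgue outer measure on R^d; Lebesgue measure is its restriction to the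
   sets satisfying [lebesgue_measurable], which need not be Borel. *)
Definition leb (R : realType) (d : nat) (X : set 'rV[R]_d) : \bar R :=
  ereal_inf [set (\sum_(k <oo) (\prod_i ((c k).2 0 i - (c k).1 0 i))%:E)%E
            | c in box_cover X].

Definition lebesgue_measurable (R : realType) (d : nat) (X : set 'rV[R]_d) :=
  (@leb R d).-caratheodory X.

Definition translate (R : realType) (d : nat) (A : set 'rV[R]_d)
    (b : 'rV[R]_d) : set 'rV[R]_d :=
  [set a + b | a in A].

(* The norm that the library puts on 'rV[R]_d is the sup norm. *)
Definition enorm (R : realType) (d : nat) (x : 'rV[R]_d) : R :=
  Num.sqrt (\sum_i x 0 i ^+ 2).

Definition is_euclidean_ball (R : realType) (d : nat) (S : set 'rV[R]_d) :=
  exists (c : 'rV[R]_d) (r : R), 0 < r /\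
    (S = [set x | enorm (x - c) < r] \/ S = [set x | enorm (x - c) <= r]).

(* R^d with its Borel sigma-algebra. *)
Notation borel_rV R d := (g_sigma_algebraType (@open 'rV[R%type]_d)).

(* The law of X is the normalized restriction to B of Lebesgue measure. As X is
   only Borel measurable, its law is prescribed on Borel sets; B itself may be
   any Lebesgue measurable set. *)
Definition uniform_on (dO : measure_display) (Omega : measurableType dO)
    (R : realType) (P : probability Omega R) (d : nat) (B : set 'rV[R]_d)
    (X : {RV P >-> borel_rV R d}) :=
  forall E : set (borel_rV R d), measurable E ->
    distribution P X E = (leb (E `&` B) / leb B)%E.

Definition independent (dO : measure_display) (Omega : measurableType dO)
    (R : realType) (P : probability Omega R) (dT : measure_display)
    (T : measurableType dT) (n : nat) (X : 'I_n -> {RV P >-> T}) :=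
  forall (J : {set 'I_n}) (E : 'I_n -> set T),
    (forall i, i \in J -> measurable (E i)) ->
    P (\bigcap_(i in [set` J]) (X i @^-1` E i)) =
    (\prod_(i in J) P (X i @^-1` E i))%E.

(* Main.v *)
Require Import Defs.
From HB Require Import structures.
From mathcomp Require Import measurable_realfun.
From mathcomp Require Import ring lra.

Set Implicit Arguments.
Unset Strict Implicit.
Unset Printing Implicit Defensive.

Import Order.TTheory GRing.Theory Num.Theory.
Import numFieldNormedType.Exports.

Local Open Scope classical_set_scope.
Local Open Scope ring_scope.

(* Write p(z) for the chance that A + b contains z, b being uniform in B. By
   Tonelli and independence the expected measure of the union of the A + b_i is
   the integral over z of 1 - (1 - p(z))^n. For n >= 2 the function
   1 - (1 - p)^n is a mixture of the functions min(p, s), and the integral of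
   min(p, s) is that of p, which is |A|, minus that of (p - s) over
   C = {p > s}. Here the integral of p over C is, up to the factor |B|, the
   measure of {(x, y) : x in A, y in B, x + y in C}, and the Riesz rearrangement
   inequality says that this increases when A, B, C are replaced by balls of the
   same measures centered at 0.

   In dimension 1, Riesz' inequality follows from a cut: with a suitable t one
   removes from A x B the product of the right part of A and the left part of B,
   of measures |A| - t and |B| - t, and what remains meets each line x + y = z
   in measure at most t. In dimension d, Steiner symmetrization along the
   direction (1, w) does not decrease the Riesz functional, and it decreases
   |A \ A'|, A' the ball, by the amount of overlap of the sections of A \ A' and
   A' \ A. Averaged over w, this overlap is bounded below in terms of |A \ A'|,
   so that the infimum of the total excess over iterated symmetrizations is 0. *)

(** * The Borel sets of R^m and their product measure *)

(** Directions are written (1, w) rather than as unit vectors because the line of points (s, u + s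
    w) comes from product coordinates by a translation in u: Tonelli and translation invariance then
    do the work of rotation invariance. A ball centered at 0 meets every such line in an interval
    whose midpoint is linear in u, and this linearity lets the one-dimensional inequality act on
    three sets at once. The obstacle is convergence of the symmetrizations. No limit set is
    extracted: the infimum of the total excess is taken over triples inside a fixed ball whose Riesz
    functional is no smaller than the original one. The gain of a good step depends only on the size
    of the excess and on that ball, so a positive infimum would be beaten by one more step. A small
    excess suffices, since A, B, C may be replaced by the balls at a loss of at most a constant
    times the measures of A \ A', B \ B', C \ C'. *)

Section borel_rV_measurability.
Variables (R : realType) (m : nat).

Lemma measurable_coord (i : 'I_m) :
  measurable_fun setT (fun x : borel_rV R m => (x : 'rV[R]_m) 0 i).
Proof.
apply: (measurability _ (RGenOpens.measurableE R)).
move=> _ [_ [a [b ->]] <-]; rewrite setTI; apply: sub_sigma_algebra.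
rewrite openE => x /= axb.
exists (fun i' j => if j == i then `]a, b[%classic else setT) => [i' j|y /= yP].
  have [->|_] := eqVneq j i; last exact: filterT.
  by rewrite (ord1 i'); apply: open_nbhs_nbhs; split => //; exact: interval_open.
by have := yP 0 i; rewrite eqxx.
Qed.

(** The topology is that of the sup norm, so its balls are finite intersections of conditions on
    single coordinates, and countably many rational ones fill an open set. This reduces Borel
    measurability of a vector-valued map to its coordinates. *)
Lemma open_rVE (U : set 'rV[R]_m) : open U ->
  U = \bigcup_(ck : {ffun 'I_m -> rat} * nat)
    (if `[< [set y : 'rV[R]_m | forall i, `|ratr (ck.1 i) - y 0 i| < ck.2.+1%:R^-1] `<=` U >]
     then [set y : 'rV[R]_m | forall i, `|ratr (ck.1 i) - y 0 i| < ck.2.+1%:R^-1] else set0).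
Proof.
move=> oU; apply/seteqP; split => [x Ux|x [[c k] _ /=]]; last first.
  by case: ifPn => // /asboolP sub /sub.
have : nbhs x U by apply: open_nbhs_nbhs; split.
rewrite -nbhs_ballE => -[e /= e0 xeU].
(* The factor 2 pays for two distances: from x to the rational center, and from the center to any
   other point of the rational ball. *)
have [k ke] : exists k, 2 * k.+1%:R^-1 < e :> R.
  exists (Num.bound (2 / e)).
  rewrite ltr_pdivrMr ?ltr0n// mulrC -ltr_pdivrMr//.
  have := archi_boundP (ltW (divr_gt0 (ltr0Sn R 1) e0)).
  move=> /lt_le_trans; apply; by rewrite ler_nat.
have Hq i : exists q : rat, `|ratr q - x 0 i| < k.+1%:R^-1.
  have k0 : 0 < k.+1%:R^-1 :> R by rewrite invr_gt0 ltr0n.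
  have : x 0 i - k.+1%:R^-1 < x 0 i + k.+1%:R^-1.
    by move: (k.+1%:R^-1) k0 => z z0; lra.
  move=> /rat_in_itvoo.
  case.
  move=> q; rewrite in_itv/= => /andP[h1 h2]; exists q.
  by rewrite ltr_norml; move: (k.+1%:R^-1) k0 h1 h2 => z z0 h1 h2; apply/andP; split; lra.
have [c cP] := choice Hq.
exists ([ffun i => c i], k) => //=.
case: ifPn => [_ i|/asboolP[]]; first by rewrite ffunE.
move=> y /= yP; apply: xeU; split => // i' j; rewrite (ord1 i').
rewrite /ball/=; have := yP j; rewrite ffunE; have := cP j.
rewrite !ltr_norml; move: (k.+1%:R^-1) ke => z ke /andP[h1 h2] /andP[h3 h4]; apply/andP; split; lra.
Qed.

Lemma measurable_rV d (T : measurableType d) (f : T -> borel_rV R m) :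
  (forall i, measurable_fun setT (fun t => (f t : 'rV[R]_m) 0 i)) ->
  measurable_fun setT f.
Proof.
move=> mf; apply: (@measurability _ _ T (borel_rV R m) setT f (@open 'rV[R]_m) erefl).
move=> _ [U oU <-]; rewrite setTI (open_rVE oU) preimage_bigcup.
apply: countable_bigcupT_measurable => // -[c k] /=.
case: ifPn => _; last by rewrite preimage_set0.
rewrite [X in measurable X](_ : _ = \bigcap_(i in [set: 'I_m])
   ((fun t => (f t : 'rV[R]_m) 0 i) @^-1` (ball (ratr (c i) : R) k.+1%:R^-1))); last first.
  by apply/seteqP; split => [t /= h i _|t h i]; [exact: h|exact: h].
apply: fin_bigcap_measurable; first exact: finite_finset.
by move=> i _; rewrite -[X in measurable X]setTI; apply: mf => //; exact: measurable_ball.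
Qed.

End borel_rV_measurability.

(** * Splitting off the first coordinate *)

Section vcons.
Variables (R : realType) (m : nat).

(** Being measurable in both directions, this bijection carries the product measure, and Tonelli's
    theorem with it, over to a space whose sigma-algebra is generated by open sets. *)
Definition vcons (p : measurableTypeR R * borel_rV R m) : borel_rV R m.+1 :=
  (\row_i if unlift ord0 i is Some j then (p.2 : 'rV[R]_m) 0 j else p.1 : R) : 'rV[R]_m.+1.

Definition vtail (x : borel_rV R m.+1) : borel_rV R m :=
  (\row_j (x : 'rV[R]_m.+1) 0 (lift ord0 j)) : 'rV[R]_m.

Definition vuncons (x : borel_rV R m.+1) : measurableTypeR R * borel_rV R m :=
  ((x : 'rV[R]_m.+1) 0 ord0, vtail x).

Lemma vcons0 p : (vcons p : 'rV[R]_m.+1) 0 ord0 = p.1.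
Proof. by rewrite mxE unlift_none. Qed.

Lemma vconsS p j : (vcons p : 'rV[R]_m.+1) 0 (lift ord0 j) = (p.2 : 'rV[R]_m) 0 j.
Proof. by rewrite mxE liftK. Qed.

Lemma vconsK : cancel vcons vuncons.
Proof.
move=> [s u]; rewrite /vuncons vcons0; congr pair.
by apply/rowP => j; rewrite mxE vconsS.
Qed.

Lemma vunconsK : cancel vuncons vcons.
Proof.
move=> x; apply/rowP => i; case: (unliftP ord0 i) => [j ->|->].
  by rewrite vconsS mxE.
by rewrite vcons0.
Qed.

Lemma measurable_vcons : measurable_fun setT vcons.
Proof.
apply: measurable_rV => i; case: (unliftP ord0 i) => [j ->|->].
  under eq_fun do rewrite vconsS.
  exact: (measurableT_comp (measurable_coord j) measurable_snd).
under eq_fun do rewrite vcons0.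
exact: measurable_fst.
Qed.

Lemma measurable_vuncons : measurable_fun setT vuncons.
Proof.
apply: measurable_fun_pair; first exact: measurable_coord.
apply: measurable_rV => j; under eq_fun do rewrite mxE.
exact: measurable_coord.
Qed.

Lemma vconsD p q : vcons (p.1 + q.1, (p.2 : 'rV[R]_m) + (q.2 : 'rV[R]_m)) =
  (vcons p : 'rV[R]_m.+1) + (vcons q : 'rV[R]_m.+1).
Proof.
apply/rowP => i; rewrite [RHS]mxE; case: (unliftP ord0 i) => [j ->|->].
  by rewrite !vconsS mxE.
by rewrite !vcons0.
Qed.

Variable mu : {sigma_finite_measure set (borel_rV R m) -> \bar R}.

Definition vcons_measure : set (borel_rV R m.+1) -> \bar R :=
  pushforward (@lebesgue_measure R \x mu)%E vcons.

Let pm : {measure set (borel_rV R m.+1) -> \bar R} :=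
  measure_function_pushforward__canonical__measure_function_Measure
    (@lebesgue_measure R \x mu)%E measurable_vcons.

HB.instance Definition _ := isMeasure.Build _ _ _ vcons_measure
  (@measure0 _ _ _ pm) (@measure_ge0 _ _ _ pm)
  (@measure_semi_sigma_additive _ _ _ pm).

Let vcons_sigma_finite : sigma_finite setT vcons_measure.
Proof.
have /sigma_finiteP[F [TF ndF Foo]] := sigma_finiteT (@lebesgue_measure R).
have /sigma_finiteP[G [TG ndG Goo]] := sigma_finiteT mu.
have mFG k : measurable (F k `*` G k).
  by apply: measurableX; [exact: (Foo k).1|exact: (Goo k).1].
exists (fun k => vuncons @^-1` (F k `*` G k)).
  apply/seteqP; split => // x _.
  have [i _ Fi] : (\bigcup_i F i) (vuncons x).1 by rewrite -TF.
  have [j _ Gj] : (\bigcup_i G i) (vuncons x).2 by rewrite -TG.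
  exists (maxn i j) => //; split.
    exact: (subsetPset _ _ (ndF _ _ (leq_maxl i j))).
  exact: (subsetPset _ _ (ndG _ _ (leq_maxr i j))).
move=> k; split.
  by rewrite -[X in measurable X]setTI; exact: measurable_vuncons.
rewrite /vcons_measure /pushforward (_ : _ @^-1` _ = F k `*` G k); last first.
  by apply/funext => p; rewrite /preimage /mkset vconsK.
have [? ?] := Foo k; have [? ?] := Goo k.
by rewrite product_measure1E// lte_mul_pinfty// ge0_fin_numE.
Qed.

HB.instance Definition _ := Measure_isSigmaFinite.Build _ _ _ vcons_measure
  vcons_sigma_finite.
End vcons.

Section muV.
Variable R : realType.

Fixpoint muV_rec m : {sigma_finite_measure set (borel_rV R m) -> \bar R} :=
  match m with
  | 0 => @dirac _ (borel_rV R 0) (0 : 'rV[R]_0) R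
  | m'.+1 => vcons_measure (muV_rec m')
  end.

(* Lebesgue measure on the Borel sets, as an iterated product measure in order
   to have Tonelli's theorem; see [lebS_borel]. *)
Definition muV m : set (borel_rV R m) -> \bar R := muV_rec m.
Arguments muV : clear implicits.

HB.instance Definition _ m := SigmaFiniteMeasure.copy (muV m) (muV_rec m).

Lemma muVS m (A : set (borel_rV R m.+1)) :
  muV m.+1 A = (@lebesgue_measure R \x muV m)%E (@vcons R m @^-1` A).
Proof. by []. Qed.

Definition vprod m (E : 'I_m -> set R) : set (borel_rV R m) :=
  [set x | forall i, E i ((x : 'rV[R]_m) 0 i)].

Lemma measurable_vprod m (E : 'I_m -> set (measurableTypeR R)) :
  (forall i, measurable (E i)) -> measurable (vprod E).
Proof.
move=> mE; rewrite [X in measurable X](_ : _ = \bigcap_(i in [set: 'I_m])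
   ((fun t : borel_rV R m => (t : 'rV[R]_m) 0 i) @^-1` (E i))); last first.
  by apply/seteqP; split => [t /= h i _|t h i]; [exact: h|exact: h].
apply: fin_bigcap_measurable; first exact: finite_finset.
by move=> i _; rewrite -[X in measurable X]setTI; apply: measurable_coord => //; exact: mE.
Qed.

Lemma muV_vprod m (E : 'I_m -> set (measurableTypeR R)) :
  (forall i, measurable (E i)) ->
  muV m (vprod E) = (\prod_(i < m) @lebesgue_measure R (E i))%E.
Proof.
elim: m E => [|m IH] E mE.
  by rewrite big_ord0 /muV/= diracE mem_set// => -[].
rewrite muVS (_ : _ @^-1` _ = E ord0 `*` vprod (fun j => E (lift ord0 j))); last first.
  apply/seteqP; split => [[s u] /= h|[s u] /= [h1 h2] i].
    by split => [|j]; [have := h ord0; rewrite vcons0|have := h (lift ord0 j); rewrite vconsS].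
  by case: (unliftP ord0 i) => [j ->|->]; rewrite ?vcons0 ?vconsS//; exact: h2.
rewrite product_measure1E//; last by apply: measurable_vprod => j; exact: mE.
by rewrite big_ord_recl; congr (_ * _)%E; apply: IH => j; exact: mE.
Qed.

End muV.

Arguments muV : clear implicits.

(** * Uniqueness of the Borel measure with given values on boxes *)

Section uniqueness.
Variables (R : realType) (m : nat).

Definition half_spaces : set (set 'rV[R]_m) :=
  [set X | exists i c, X = [set x : 'rV[R]_m | c < x 0 i]].

(** Give the source of the identity map the sigma-algebra generated by the half-spaces. Its
    coordinates are measurable by construction, and measurability of the identity is then the
    desired inclusion. *)
Lemma borel_half_spaces (A : set (borel_rV R m)) :
  measurable A -> <<s half_spaces >> A.
Proof.
move=> mA; have : measurable_fun setT (id : g_sigma_algebraType half_spaces -> borel_rV R m).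
  apply: measurable_rV => i.
  apply: (measurability _ (RGenOInfty.measurableE R)).
  move=> _ [_ [c ->] <-]; rewrite setTI; apply: sub_sigma_algebra.
  by exists i, c; apply/seteqP; split => x /=; rewrite in_itv/= andbT.
by move=> /(_ measurableT A mA); rewrite setTI.
Qed.

Definition boxes : set (set 'rV[R]_m) := [set X | exists a b, X = box a b].

Lemma boxE (a b : 'rV[R]_m) : box a b = vprod (fun i => `]a 0 i, b 0 i]%classic).
Proof. by apply/seteqP; split => x /= h i; have := h i; rewrite /= in_itv. Qed.

Lemma measurable_box (a b : 'rV[R]_m) : measurable (box a b : set (borel_rV R m)).
Proof. by rewrite boxE; apply: measurable_vprod => i; exact: measurable_itv. Qed.

Definition cube (r : R) : set 'rV[R]_m := box (const_mx (- r)) (const_mx r).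

Lemma box_cube_cover : \bigcup_k cube k%:R = [set: 'rV[R]_m].
Proof.
apply/seteqP; split => // x _.
pose M := \sum_i `|x 0 i|.
exists (Num.bound M).+1 => // i; rewrite !mxE.
have M0 : 0 <= M by apply: sumr_ge0.
have xM : `|x 0 i| <= M by rewrite /M (bigD1 i)//= lerDl sumr_ge0.
have : M < (Num.bound M).+1%:R.
  by rewrite (lt_le_trans (archi_boundP M0))// ler_nat.
move=> Mlt; have := le_lt_trans xM Mlt; rewrite ltr_norml => /andP[-> /ltW ->]//.
Qed.

Lemma box_setI (a b c d : 'rV[R]_m) : box a b `&` box c d =
  box (\row_i Num.max (a 0 i) (c 0 i)) (\row_i Num.min (b 0 i) (d 0 i)).
Proof.
apply/seteqP; split => x /=.
  move=> [h1 h2] i; rewrite !mxE; have := h1 i; have := h2 i.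
  by rewrite gt_max le_min => /andP[-> ->] /andP[-> ->].
move=> h; split => i; have := h i; rewrite !mxE gt_max le_min.
  by move=> /andP[/andP[-> _] /andP[-> _]].
by move=> /andP[/andP[_ ->] /andP[_ ->]].
Qed.

Lemma borel_boxes : @measurable _ (borel_rV R m) = <<s boxes >>.
Proof.
apply/seteqP; split => [A /borel_half_spaces|]; last first.
  apply: smallest_sub; first exact: sigma_algebra_measurable.
  by move=> _ [a [b ->]]; exact: measurable_box.
apply: smallest_sub; first exact: smallest_sigma_algebra.
move=> _ [i [c ->]].
rewrite (_ : [set x | _] = \bigcup_k
   box (\row_j (if j == i then Num.max c (- k%:R) else - k%:R)) (const_mx k%:R)).
  apply: (@bigcupT_measurable _ (g_sigma_algebraType boxes)) => k.
  by apply: sub_sigma_algebra; eexists; eexists.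
apply/seteqP; split => x /=.
  move=> cx; have : setT x by [].
  rewrite -box_cube_cover => -[k _ /= h]; exists k => // j; have := h j.
  rewrite !mxE => /andP[h1 h2]; rewrite h2 andbT.
  by case: eqP => // ->; rewrite gt_max cx /=; have := h i; rewrite !mxE => /andP[].
move=> [k _ /(_ i)]; rewrite !mxE eqxx gt_max => /andP[/andP[]]//.
Qed.

Lemma muV_box (a b : 'rV[R]_m) : (forall i, a 0 i <= b 0 i) ->
  muV R m (box a b) = (\prod_i (b 0 i - a 0 i))%:E.
Proof.
move=> ab; rewrite boxE muV_vprod//.
rewrite -prodEFin; apply: eq_bigr => i _; rewrite lebesgue_measure_itv/= lte_fin.
have := ab i; rewrite le_eqVlt => /predU1P[->|->]; first by rewrite ltxx subrr.
by rewrite EFinB.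
Qed.

Lemma box_set0 (a b : 'rV[R]_m) i : b 0 i < a 0 i -> box a b = set0.
Proof.
move=> ba; apply/seteqP; split => // x /(_ i) /andP[h1 h2].
by have := lt_le_trans h1 h2; rewrite ltNge (ltW ba).
Qed.

(** Boxes form a generating pi-system and the cubes exhaust the space with finite measure. The lemma
    serves twice: for affine changes of variables and to identify the outer measure [leb] on Borel
    sets. *)
Lemma muV_unique (nu : {measure set (borel_rV R m) -> \bar R}) :
  (forall a b : 'rV[R]_m, (forall i, a 0 i <= b 0 i) ->
    nu (box a b) = (\prod_i (b 0 i - a 0 i))%:E) ->
  forall A, measurable A -> nu A = muV R m A.
Proof.
move=> nuE A mA; apply/esym.
apply: (@measure_unique _ R (borel_rV R m) boxes (fun k => cube k%:R)) => //.
- exact: borel_boxes.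
- by move=> _ _ [a [b ->]] [c [d ->]]; rewrite box_setI; eexists; eexists.
- by move=> k; eexists; eexists.
- exact: box_cube_cover.
- move=> _ [a [b ->]].
  have [/forallP ab|/forallPn[i]] := boolP [forall i, a 0 i <= b 0 i].
    by rewrite nuE//; exact: muV_box.
  by rewrite -ltNge => /box_set0 ->; rewrite !measure0.
- move=> k; suff : (muV R m (cube k%:R) < +oo)%E by [].
  rewrite muV_box ?ltry// => i.
  by rewrite !mxE lerNl (le_trans (_ : - k%:R <= 0))// ?oppr_le0// ler0n.
Qed.

End uniqueness.

(** * Affine changes of variables *)

Section affine.
Variable R : realType.

Let afm d d' (T1 : measurableType d) (T2 : measurableType d')
  (mu : {measure set T1 -> \bar R}) (f : T1 -> T2) (mf : measurable_fun setT f)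
  (c : R) : {measure set T2 -> \bar R} :=
  mscale (NngNum (normr_ge0 c))
   (measure_function_pushforward__canonical__measure_function_Measure mu mf).

Lemma lebesgue_preimage_affine_ocitv (c d a b : R) : c != 0 -> a <= b ->
  @lebesgue_measure R ((fun x => c * x + d) @^-1` `]a, b]%classic) = ((b - a) / `|c|)%:E.
Proof.
move=> c0 ab; have [cp|cn|c00] := ltgtP c 0; last by rewrite c00 eqxx in c0.
  rewrite (_ : _ @^-1` _ = `[(b - d) / c, (a - d) / c[%classic); last first.
    apply/seteqP; split => x /=; rewrite !in_itv/= => /andP[h1 h2].
      by rewrite ler_ndivrMr// ltr_ndivlMr//; apply/andP; split; lra.
    by move: h1 h2; rewrite ler_ndivrMr// ltr_ndivlMr// => h1 h2; apply/andP; split; lra.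
  rewrite lebesgue_measure_itv/= lte_fin ltr_nM2r ?invr_lt0// ltrD2r.
  move: ab; rewrite le_eqVlt => /predU1P[->|->]; first by rewrite ltxx subrr mul0r.
  by rewrite -EFinB ltr0_norm//; congr EFin; field.
rewrite (_ : _ @^-1` _ = `](a - d) / c, (b - d) / c]%classic); last first.
  apply/seteqP; split => x /=; rewrite !in_itv/= => /andP[h1 h2].
    by rewrite ltr_pdivrMr// ler_pdivlMr//; apply/andP; split; lra.
  by move: h1 h2; rewrite ltr_pdivrMr// ler_pdivlMr// => h1 h2; apply/andP; split; lra.
rewrite lebesgue_measure_itv/= lte_fin ltr_pM2r ?invr_gt0// ltrD2r.
move: ab; rewrite le_eqVlt => /predU1P[->|->]; first by rewrite ltxx subrr mul0r.
by rewrite -EFinB gtr0_norm//; congr EFin; field.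
Qed.

Lemma measurable_affine1 (c d : R) :
  measurable_fun setT ((fun x => c * x + d) : measurableTypeR R -> measurableTypeR R).
Proof. by apply: measurable_funD => //; exact: measurable_funM. Qed.

Lemma lebesgue_affine (c d : R) (A : set (measurableTypeR R)) : c != 0 -> measurable A ->
  (`|c|%:E * @lebesgue_measure R ((fun x => (c * x + d)%R) @^-1` A) = @lebesgue_measure R A)%E.
Proof.
move=> c0 mA; rewrite [RHS](@lebesgue_measure_unique _ (afm (@lebesgue_measure R) (measurable_affine1 c d) c))//.
move=> _ [[a b] _ <-] /=; rewrite /mscale/= /pushforward.
have [ab|ba] := leP a b; last first.
  by rewrite set_itv_ge ?preimage_set0 ?measure0 ?mule0// bnd_simp -leNgt ltW.
rewrite lebesgue_preimage_affine_ocitv// lebesgue_measure_itv/= lte_fin -EFinM.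
have cn0 : `|c| != 0 by rewrite normr_eq0.
rewrite mulrCA divff// mulr1 -EFinB.
by move: ab; rewrite le_eqVlt => /predU1P[->|->]//; rewrite ltxx subrr.
Qed.

Variable m : nat.

Lemma measurable_affine (c : R) (d : 'rV[R]_m) :
  measurable_fun setT ((fun x : 'rV[R]_m => c *: x + d) : borel_rV R m -> borel_rV R m).
Proof.
apply: measurable_rV => i; under eq_fun do rewrite !mxE.
by apply: measurable_funD => //; apply: measurable_funM => //; exact: measurable_coord.
Qed.

Lemma muV_affine (c : R) (d : 'rV[R]_m) (A : set (borel_rV R m)) : c != 0 -> measurable A ->
  ((`|c| ^+ m)%:E * muV R m ((fun x : 'rV[R]_m => (c *: x + d)%R) @^-1` A) = muV R m A)%E.
Proof.
move=> c0 mA.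
have cn0 : `|c| != 0 by rewrite normr_eq0.
transitivity (afm (muV R m) (measurable_affine c d) (`|c| ^+ m) A).
  by rewrite /= /mscale /pushforward/= normrX normr_id.
apply: muV_unique => // a b ab; rewrite /= /mscale/= /pushforward.
rewrite (_ : _ @^-1` _ = vprod (fun i => (fun x => c * x + d 0 i) @^-1` `]a 0 i, b 0 i]%classic)); last first.
  by apply/seteqP; split => x /= h i; have := h i; rewrite /= !mxE ?in_itv/=.
rewrite muV_vprod; last first.
  move=> i; rewrite -[X in measurable X]setTI; apply: measurable_affine1 => //.
rewrite (eq_bigr (fun i => ((b 0 i - a 0 i) / `|c|)%:E)); last first.
  by move=> i _; rewrite lebesgue_preimage_affine_ocitv.
rewrite prodEFin -EFinM; congr EFin.
rewrite big_split/= prodr_const card_ord exprVn normrX normr_id mulrCA divff ?mulr1//.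
by rewrite expf_neq0.
Qed.

End affine.

(** * Tonelli's theorem and integration along lines *)

Section integral_tools.
Local Open Scope ereal_scope.

(** The integral of a nonnegative function is a supremum over simple functions below it, hence
    monotone even where measurability is unknown. The theorem relies on this for translates of a set
    A that is merely Lebesgue measurable. *)
Lemma integral_leT d (T : measurableType d) (R : realType)
  (mu : {measure set T -> \bar R}) (f g : T -> \bar R) :
  (forall x, 0 <= f x) -> (forall x, f x <= g x) ->
  \int[mu]_x f x <= \int[mu]_x g x.
Proof.
move=> f0 fg; rewrite !ge0_integralTE//; last by move=> x; exact: le_trans (fg x).
apply: le_ereal_sup => _ [h /= hf <-]; exists h => // x.
exact: le_trans (fg x).
Qed.

Lemma integral_swap d1 d2 (T1 : measurableType d1) (T2 : measurableType d2)
  (R : realType) (m1 : {sigma_finite_measure set T1 -> \bar R})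
  (m2 : {sigma_finite_measure set T2 -> \bar R}) (f : T1 -> T2 -> \bar R) :
  measurable_fun setT (fun p => f p.1 p.2) -> (forall x y, 0 <= f x y) ->
  \int[m1]_x \int[m2]_y f x y = \int[m2]_y \int[m1]_x f x y.
Proof.
by move=> mf f0; exact: (@fubini_tonelli _ _ _ _ _ m1 m2 (fun p => f p.1 p.2) mf (fun p => f0 _ _)).
Qed.

Lemma measurable_integral2 d1 d2 (T1 : measurableType d1) (T2 : measurableType d2)
  (R : realType) (m2 : {sigma_finite_measure set T2 -> \bar R}) (f : T1 -> T2 -> \bar R) :
  measurable_fun setT (fun p => f p.1 p.2) -> (forall x y, 0 <= f x y) ->
  measurable_fun setT (fun x => \int[m2]_y f x y).
Proof.
by move=> mf f0; exact: (@measurable_fun_fubini_tonelli_F _ _ _ _ _ m2 (fun p => f p.1 p.2) mf (fun p => f0 _ _)).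
Qed.

Lemma integralTE d (T : measurableType d) (R : realType)
  (mu : {measure set T -> \bar R}) (E : set T) : measurable E ->
  mu E = \int[mu]_x (\1_E x)%:E.
Proof. by move=> mE; rewrite integral_indic// setIT. Qed.

Lemma product_measureE d1 d2 (T1 : measurableType d1) (T2 : measurableType d2)
  (R : realType) (m1 : {sigma_finite_measure set T1 -> \bar R})
  (m2 : {sigma_finite_measure set T2 -> \bar R}) (E : set (T1 * T2)) :
  measurable E -> (m1 \x m2) E = \int[m1]_x \int[m2]_y (\1_E (x, y))%:E.
Proof.
move=> mE; rewrite /product_measure1; apply: eq_integral => x _ /=.
rewrite integralTE; last exact: measurable_xsection.
by apply: eq_integral => y _; rewrite !indicE mem_xsection.
Qed.

Lemma measurable_indicE d (T : measurableType d) (R : realType) (E : set T) :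
  measurable E -> measurable_fun setT (fun x => (\1_E x : R)%:E).
Proof. by move=> mE; apply/measurable_EFinP; exact: measurable_indic. Qed.

Lemma measurable_preT d1 d2 (T1 : measurableType d1) (T2 : measurableType d2)
  (f : T1 -> T2) (E : set T2) : measurable_fun setT f -> measurable E ->
  measurable (f @^-1` E).
Proof. by move=> mf mE; rewrite -[X in measurable X]setTI; exact: mf. Qed.
End integral_tools.

Section integral_muV.
Local Open Scope ereal_scope.
Variable R : realType.

Lemma ge0_integral_lebesgue_affine (c d : R) (f : measurableTypeR R -> \bar R) :
  c != 0%R -> measurable_fun setT f -> (forall x, 0 <= f x) ->
  \int[@lebesgue_measure R]_x f x = `|c|%:E * \int[@lebesgue_measure R]_x f (c * x + d)%R.
Proof.
move=> c0 mf f0.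
pose pf := measure_function_pushforward__canonical__measure_function_Measure
  (@lebesgue_measure R) (measurable_affine1 c d).
rewrite (eq_measure_integral (mscale (NngNum (normr_ge0 c)) pf)); last first.
  by move=> A mA _ /=; rewrite /mscale/= /pushforward lebesgue_affine.
rewrite ge0_integral_mscale//=; congr (_ * _).
by rewrite ge0_integral_pushforward//; exact: measurable_affine1.
Qed.

Lemma ge0_integral_muV_affine m (c : R) (d : 'rV[R]_m) (f : borel_rV R m -> \bar R) :
  c != 0%R -> measurable_fun setT f -> (forall x, 0 <= f x) ->
  \int[muV R m]_x f x = (`|c| ^+ m)%:E * \int[muV R m]_x f (c *: (x : 'rV[R]_m) + d)%R.
Proof.
move=> c0 mf f0.
pose pf := measure_function_pushforward__canonical__measure_function_Measure
  (muV R m) (measurable_affine c d).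
have cm0 : (0 <= `|c| ^+ m)%R by rewrite exprn_ge0.
rewrite (eq_measure_integral (mscale (NngNum cm0) pf)); last first.
  by move=> A mA _ /=; rewrite /mscale/= /pushforward muV_affine.
rewrite ge0_integral_mscale//=; congr (_ * _).
by rewrite ge0_integral_pushforward//; exact: measurable_affine.
Qed.

Lemma ge0_integral_lebesgue_shift (d : R) (f : measurableTypeR R -> \bar R) :
  measurable_fun setT f -> (forall x, 0 <= f x) ->
  \int[@lebesgue_measure R]_x f (x + d)%R = \int[@lebesgue_measure R]_x f x.
Proof.
move=> mf f0; rewrite [RHS](@ge0_integral_lebesgue_affine 1 d)// ?oner_eq0// normr1 mul1e.
by apply: eq_integral => x _; rewrite mul1r.
Qed.

Lemma ge0_integral_muV_shift m (d : 'rV[R]_m) (f : borel_rV R m -> \bar R) :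
  measurable_fun setT f -> (forall x, 0 <= f x) ->
  \int[muV R m]_x f ((x : 'rV[R]_m) + d)%R = \int[muV R m]_x f x.
Proof.
move=> mf f0; rewrite [RHS](@ge0_integral_muV_affine _ 1 d)// ?oner_eq0// normr1 expr1n mul1e.
by apply: eq_integral => x _; rewrite scale1r.
Qed.

Lemma ge0_integral_muVS m (f : borel_rV R m.+1 -> \bar R) :
  measurable_fun setT f -> (forall x, 0 <= f x) ->
  \int[muV R m.+1]_x f x = \int[@lebesgue_measure R]_s \int[muV R m]_u f (vcons (s, u)).
Proof.
move=> mf f0.
pose pf := measure_function_pushforward__canonical__measure_function_Measure
  (@lebesgue_measure R \x muV R m)%E (@measurable_vcons R m).
rewrite (eq_measure_integral pf)//.
rewrite ge0_integral_pushforward//; last exact: measurable_vcons.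
rewrite preimage_setT.
apply: (@fubini_tonelli1 _ _ _ _ _ (@lebesgue_measure R) (muV R m) (f \o @vcons R m)) => [|p].
  by apply: measurableT_comp => //; exact: measurable_vcons.
exact: f0.
Qed.

Lemma measurable_addV m d (T : measurableType d) (f g : T -> borel_rV R m) :
  measurable_fun setT f -> measurable_fun setT g ->
  measurable_fun setT ((fun x => (f x : 'rV[R]_m) + g x)%R : T -> borel_rV R m).
Proof.
move=> mf mg; apply: measurable_rV => i; under eq_fun do rewrite !mxE.
by apply: measurable_funD; exact: (measurableT_comp (measurable_coord i)).
Qed.

Lemma measurable_subV m d (T : measurableType d) (f g : T -> borel_rV R m) :
  measurable_fun setT f -> measurable_fun setT g ->
  measurable_fun setT ((fun x => (f x : 'rV[R]_m) - g x)%R : T -> borel_rV R m).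
Proof.
move=> mf mg; apply: measurable_rV => i; under eq_fun do rewrite !mxE.
by apply: measurable_funB; exact: (measurableT_comp (measurable_coord i)).
Qed.

Lemma measurable_scaleV m d (T : measurableType d) (f : T -> measurableTypeR R) (g : T -> borel_rV R m) :
  measurable_fun setT f -> measurable_fun setT g ->
  measurable_fun setT ((fun x => (f x : R) *: (g x : 'rV[R]_m))%R : T -> borel_rV R m).
Proof.
move=> mf mg; apply: measurable_rV => i; under eq_fun do rewrite !mxE.
by apply: measurable_funM => //; exact: (measurableT_comp (measurable_coord i)).
Qed.

End integral_muV.

Section lines.
Local Open Scope ereal_scope.
Variables (R : realType) (m : nat).
Implicit Types (u v w : 'rV[R]_m) (s t : R).

Definition line w u s : borel_rV R m.+1 := vcons (s, (u + s *: w)%R).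

(** Additivity jointly in base point and parameter turns the condition x + y in C into a
    one-dimensional condition on the line over u + v. *)
Lemma lineD w u v s t : line w (u + v)%R (s + t)%R =
  ((line w u s : 'rV[R]_m.+1) + line w v t)%R.
Proof. by rewrite /line -vconsD/= scalerDl addrACA. Qed.

Lemma measurable_line d (T : measurableType d) (f h : T -> borel_rV R m) (g : T -> measurableTypeR R) :
  measurable_fun setT f -> measurable_fun setT g -> measurable_fun setT h ->
  measurable_fun setT (fun x => line (h x) (f x) (g x)).
Proof.
move=> mf mg mh; apply: (measurableT_comp (@measurable_vcons R m)).
by apply: measurable_fun_pair => //; apply: measurable_addV => //; exact: measurable_scaleV.
Qed.

(** At fixed height s the shear u -> u + s w is a translation, so it preserves the inner integral;
    afterwards the two integrals are swapped. *)
Lemma ge0_integral_line w (f : borel_rV R m.+1 -> \bar R) :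
  measurable_fun setT f -> (forall x, 0 <= f x) ->
  \int[muV R m.+1]_x f x = \int[muV R m]_u \int[@lebesgue_measure R]_s f (line w u s).
Proof.
move=> mf f0; rewrite ge0_integral_muVS//.
transitivity (\int[@lebesgue_measure R]_s \int[muV R m]_u f (line w u s)).
  apply: eq_integral => s _.
  rewrite -(@ge0_integral_muV_shift _ _ (s *: w)%R (fun u => f (vcons (s, u))))//.
  by apply: measurableT_comp => //; apply: (measurableT_comp (@measurable_vcons R m)); exact: measurable_fun_pair.
apply: integral_swap => //; apply: measurableT_comp => //.
by apply: measurable_line.
Qed.

Lemma product_measure_line w (E : set (borel_rV R m.+1 * borel_rV R m.+1)) :
  measurable E ->
  (muV R m.+1 \x muV R m.+1) E = \int[muV R m]_u \int[muV R m]_v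
    (@lebesgue_measure R \x @lebesgue_measure R) [set p | E (line w u p.1, line w v p.2)].
Proof.
move=> mE; rewrite product_measureE//.
have mI : measurable_fun setT (fun p : borel_rV R m.+1 * borel_rV R m.+1 => (\1_E p : R)%:E).
  exact: measurable_indicE.
rewrite (@ge0_integral_line w); last 2 first.
- apply: measurable_integral2 => //; rewrite (_ : (fun p => _) = (fun p => (\1_E p)%:E))//.
  by apply/funext => -[].
- by move=> x; exact: integral_ge0.
apply: eq_integral => u _.
transitivity (\int[@lebesgue_measure R]_s \int[muV R m]_v \int[@lebesgue_measure R]_t
   (\1_E (line w u s, line w v t) : R)%:E).
  apply: eq_integral => s _; rewrite (@ge0_integral_line w)//.
  by apply: measurableT_comp mI _; exact: measurable_fun_pair.
rewrite (@integral_swap _ _ (measurableTypeR R) (borel_rV R m) R (@lebesgue_measure R) (muV R m)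
  (fun s v => \int[@lebesgue_measure R]_t (\1_E (line w u s, line w v t) : R)%:E)); last 2 first.
- apply: (@measurable_integral2 _ _ (measurableTypeR R * borel_rV R m)%type (measurableTypeR R) R
    (@lebesgue_measure R) (fun p t => (\1_E (line w u p.1, line w p.2 t))%:E)) => //.
  apply: (measurableT_comp mI); apply: measurable_fun_pair.
    by apply: measurable_line => //; exact: measurableT_comp.
  apply: measurable_line => //; exact: measurableT_comp.
- by move=> s v; apply: integral_ge0 => t _.
apply: eq_integral => v _; rewrite product_measureE//.
apply: (@measurable_preT _ _ _ _ (fun p => (line w u p.1, line w v p.2))) => //.
by apply: measurable_fun_pair; apply: measurable_line.
Qed.

End lines.

(** * The Riesz inequality on the line *)

(** Its product measure is the Riesz functional, the integral over C of the convolution of the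
    indicators of A and B. *)
Definition triset (T : zmodType) (A B C : set T) : set (T * T) :=
  [set p | [/\ A p.1, B p.2 & C (p.1 + p.2)]].

Section riesz1.
Local Open Scope ereal_scope.
Variable R : realType.
Local Notation lam := (@lebesgue_measure R).
Local Notation RM := (measurableTypeR R).
Implicit Types A B C : set RM.

Lemma le_mu d (T : measurableType d) (mu : {measure set T -> \bar R}) (A B : set T) :
  measurable A -> measurable B -> A `<=` B -> mu A <= mu B.
Proof. by move=> mA mB AB; apply: le_measure; rewrite ?inE. Qed.

Lemma lam_bounded A L : measurable A -> A `<=` `[(- L)%R, L]%classic ->
  lam A \is a fin_num.
Proof.
move=> mA AL; rewrite ge0_fin_numE//; apply: (@le_lt_trans _ _ (lam `[(- L)%R, L]%classic)).
  exact: le_mu.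
by rewrite lebesgue_measure_itv/=; case: ifPn => _; rewrite ?ltry.
Qed.

Lemma measurable_triset A B C : measurable A -> measurable B -> measurable C ->
  measurable (triset A B C : set (RM * RM)).
Proof.
move=> mA mB mC.
rewrite (_ : triset A B C = (fst @^-1` A `&` snd @^-1` B) `&` (fun p : RM * RM => (p.1 + p.2)%R) @^-1` C); last first.
  by apply/seteqP; split => [p [? ? ?]|p [[? ?] ?]].
apply: measurableI; first by apply: measurableI; apply: measurable_preT.
by apply: measurable_preT => //; apply: measurable_funD.
Qed.

Lemma product_measure_shear1 (E : set (RM * RM)) : measurable E ->
  (lam \x lam) E = \int[lam]_z \int[lam]_x (\1_E (x, z - x)%R)%:E.
Proof.
move=> mE; rewrite (product_measureE lam lam mE).
have mI : measurable_fun setT (fun p : RM * RM => (\1_E p : R)%:E).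
  exact: measurable_indicE.
transitivity (\int[lam]_x \int[lam]_z (\1_E (x, z - x)%R : R)%:E).
  apply: eq_integral => x _.
  rewrite -(@ge0_integral_lebesgue_shift _ (- x)%R (fun y => (\1_E (x, y))%:E))//.
  by apply: (measurableT_comp mI); exact: measurable_fun_pair.
apply: integral_swap => //; apply: (measurableT_comp mI).
by apply: measurable_fun_pair => //; exact: measurable_funB.
Qed.

(** The measure of the part of A left of x is 1-Lipschitz in x, so the intermediate value theorem
    gives the cut. *)
Lemma cut_left A L (t : R) : measurable A -> A `<=` `[(- L)%R, L]%classic ->
  (0 <= t)%R -> t%:E <= lam A ->
  exists x0, lam (A `&` `]-oo, x0]%classic) = t%:E.
Proof.
move=> mA AL t0 tA.
have mAx x : measurable (A `&` `]-oo, x]%classic) by exact: measurableI.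
have fA := lam_bounded mA AL.
have fin x : lam (A `&` `]-oo, x]%classic) \is a fin_num.
  by apply: (@lam_bounded _ L) => // y [/AL].
pose f x := fine (lam (A `&` `]-oo, x]%classic)).
have fE x : lam (A `&` `]-oo, x]%classic) = (f x)%:E by rewrite /f fineK.
have lip x y : (x <= y)%R -> (f x <= f y <= f x + (y - x))%R.
  move=> xy; rewrite -!lee_fin EFinD -!fE; apply/andP; split.
    apply: le_mu => // z [Az /=]; rewrite !in_itv/= => zx; split => //=.
    exact: le_trans zx xy.
  have -> : (y - x)%:E = lam `]x, y]%classic.
    rewrite lebesgue_measure_itv/= lte_fin; move: xy; rewrite le_eqVlt => /predU1P[->|->].
      by rewrite ltxx subrr.
    by rewrite EFinB.
  apply: (le_trans _ (measureU2 _ _ _)) => //; apply: le_mu => //.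
    exact: measurableU.
  move=> z [Az /=]; rewrite !in_itv/= => zy.
  by have [zx|xz] := leP z x; [left; split => //=; rewrite ?in_itv|right; rewrite /= ?in_itv/= ?xz ?zy].
have [L0|L0] := ltP L 0%R.
  have A0 : A = set0.
    by apply/seteqP; split => // x /AL /=; rewrite ?in_itv/= => /andP[h1 h2]; lra.
  exists 0%R; rewrite A0 set0I measure0.
  by move: tA; rewrite A0 measure0 lee_fin => t0'; congr EFin; apply/eqP; rewrite eq_le t0 t0'.
have cf : continuous (f : R -> R).
  move=> x; apply/cvgrPdist_le => /= e e0; apply/nbhs_ballP; exists e => //= y.
  rewrite /ball/= => xye; apply: (le_trans _ (ltW xye)).
  have [/lip|/ltW/lip] := leP x y => /andP[h1 h2].
    rewrite ler0_norm ?subr_le0// ler0_norm; last by lra.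
    by lra.
  by rewrite !ger0_norm ?subr_ge0//; lra.
have fL : f L = fine (lam A).
  rewrite /f (_ : A `&` _ = A)//; apply/seteqP; split => [x []//|x Ax]; split => //=.
  by have := AL _ Ax; rewrite /= !in_itv/= => /andP[].
(* Starting strictly to the left of -L makes the left part empty; at -L itself it could still
   contain a point. *)
have fNL : f (- L - 1)%R = 0%R.
  rewrite /f (_ : A `&` _ = set0) ?measure0//; apply/seteqP; split => // x [/AL/=].
  by rewrite !in_itv/= => /andP[h1 h2] h3; lra.
have [|||c _ fc] := @IVT R f (- L - 1)%R L t.
- lra.
- by apply: continuous_subspaceT.
- have tf : (t <= fine (lam A))%R by rewrite -lee_fin fineK.
  by rewrite fL fNL min_l ?max_r ?t0//; apply: le_trans tf.
by exists c; rewrite fE fc.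
Qed.

Lemma lam_reflect A (d : R) : measurable A -> lam [set x | A (d - x)%R] = lam A.
Proof.
move=> mA; rewrite -[RHS](@lebesgue_affine _ (-1) d)//.
rewrite normrN1 mul1e; congr (lam _); apply/seteqP; split => x /=; by rewrite mulN1r addrC.
Qed.

Lemma measurable_reflect A (d : R) : measurable A -> measurable ([set x | A (d - x)%R] : set RM).
Proof. by move=> mA; apply: (@measurable_preT _ _ _ _ (fun x : RM => (d - x)%R : RM)) => //; exact: measurable_funB. Qed.

Lemma cut_right B L (t : R) : measurable B -> B `<=` `[(- L)%R, L]%classic ->
  (0 <= t)%R -> t%:E <= lam B ->
  exists y0, lam (B `&` `[y0, +oo[%classic) = t%:E.
Proof.
move=> mB BL t0 tB.
have [] := @cut_left [set x | B (0 - x)%R] L t.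
- exact: measurable_reflect.
- by move=> x /BL /=; rewrite !in_itv/= sub0r lerN2 lerNl andbC.
- by [].
- by rewrite lam_reflect.
move=> x0 <-; exists (- x0)%R.
rewrite -(lam_reflect 0) ?sub0r; last exact: measurableI.
congr (lam _); apply/seteqP; split => x /=; rewrite ?in_itv/= ?andbT ?sub0r => -[h1 h2]; split => //.
  by move: h2; rewrite lerN2.
by rewrite lerN2.
Qed.

(* Off the quadrant [x > x0, y < y0], which has measure (a - t)(b - t), every
   line x + y = z meets A x B in measure at most t: of the two initial pieces
   {x <= x0} and {z - x >= y0} of that line one contains the other. *)
Lemma triset_le A B C L (t : R) :
  measurable A -> measurable B -> measurable C ->
  A `<=` `[(- L)%R, L]%classic -> B `<=` `[(- L)%R, L]%classic ->
  (0 <= t)%R -> t%:E <= lam A -> t%:E <= lam B ->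
  (lam \x lam) (triset A B C) <= t%:E * lam C + (lam A - t%:E) * (lam B - t%:E).
Proof.
move=> mA mB mC AL BL t0 tA tB.
have [x0 Ax0] := cut_left mA AL t0 tA.
have [y0 By0] := cut_right mB BL t0 tB.
have fA := lam_bounded mA AL.
have fB := lam_bounded mB BL.
set A0 := A `&` _ in Ax0; set B0 := B `&` _ in By0.
have AA0 : A `&` A0 = A0 by rewrite /A0 setIA setIid.
have BB0 : B `&` B0 = B0 by rewrite /B0 setIA setIid.
have mA0 : measurable A0 by exact: measurableI.
have mB0 : measurable B0 by exact: measurableI.
have mT := measurable_triset mA mB mC.
pose E2 : set (RM * RM) := triset A B C `&` (fst @^-1` `]-oo, x0]%classic `|` snd @^-1` `[y0, +oo[%classic).
have mE2 : measurable E2.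
  by apply: measurableI => //; apply: measurableU; apply: measurable_preT.
have mAD : measurable (A `\` A0) by exact: measurableD.
have mBD : measurable (B `\` B0) by exact: measurableD.
have -> : lam A - t%:E = lam (A `\` A0).
  by rewrite measureD//; [rewrite AA0; congr (_ - _); exact: esym|rewrite ltey_eq fA].
have -> : lam B - t%:E = lam (B `\` B0).
  by rewrite measureD//; [rewrite BB0; congr (_ - _); exact: esym|rewrite ltey_eq fB].
rewrite -product_measure1E//.
apply: (@le_trans _ _ ((lam \x lam) (E2 `|` (A `\` A0) `*` (B `\` B0)))).
  apply: le_mu => //; first by apply: measurableU => //; exact: measurableX.
  move=> [x y] /= [Ax By Cxy].
  have [xx0|x0x] := leP x x0; first by left; split => //; left; rewrite /= ?in_itv.
  have [yy0|y0y] := leP y0 y; first by left; split => //; right; rewrite /= ?in_itv/= andbT.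
  right; split; split => // -[_ /=]; rewrite ?in_itv/= ?andbT.
    by rewrite leNgt x0x.
  by rewrite leNgt y0y.
apply: (le_trans (measureU2 _ _ _)) => //; first exact: measurableX.
apply: leeD2r; suff : (lam \x lam) E2 <= t%:E * lam C by [].
rewrite product_measure_shear1//.
rewrite [in leRHS]integralTE// -ge0_integralZl//; last exact: measurable_indicE.
apply: integral_leT => z; first exact: integral_ge0.
have [zC|zC] := pselect (C z); last first.
  rewrite integral0_eq ?mule_ge0 ?lee_fin// => x _.
  by rewrite indicE memNset//= => -[[_ _ /=]]; rewrite subrKC.
rewrite indicE mem_set// mule1.
pose S := if (z - y0 <= x0)%R then A0 else [set x | B0 (z - x)%R].
have mS : measurable (S : set RM) by rewrite /S; case: ifPn => _ //; exact: measurable_reflect.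
have -> : t%:E = lam S by rewrite /S; case: ifPn => _; rewrite ?lam_reflect.
rewrite [leRHS]integralTE//; apply: integral_leT => x; first by rewrite lee_fin.
rewrite lee_fin !indicE; have [|] := boolP ((x, (z - x)%R) \in E2); last by rewrite /= ler0n.
rewrite inE => -[[/= Ax Bx _]]; rewrite !in_itv/= ?andbT => h.
rewrite mem_set// /S; case: ifPn => [zy|]; last rewrite -ltNge => zy.
  by split => //=; rewrite ?in_itv/=; case: h => // h; lra.
by split => //=; rewrite ?in_itv/= andbT; case: h => // h; lra.
Qed.

End riesz1.

(** * Intervals attain the bound of the cut; Riesz' inequality in dimension 1 *)

Section riesz1_interval.
Local Open Scope ereal_scope.
Variable R : realType.
Local Notation lam := (@lebesgue_measure R).
Local Notation RM := (measurableTypeR R).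

Definition centered_itv (c l : R) : set RM := `](c - l / 2)%R, (c + l / 2)%R[%classic.

Lemma measurable_centered_itv c l : measurable (centered_itv c l).
Proof. exact: measurable_itv. Qed.
#[local] Hint Resolve measurable_centered_itv : core.

Lemma lam_centered_itv c l : (0 <= l)%R -> lam (centered_itv c l) = l%:E.
Proof.
move=> l0; rewrite lebesgue_measure_itv/= lte_fin; case: ifPn => h.
  by rewrite -EFinB; congr EFin; lra.
by congr EFin; lra.
Qed.

(** With [hi], the end points of the set of x such that x and z - x lie in the intervals centered at
    c1 and c2. *)
Let lo (c1 c2 a b z : R) : R := Num.max (c1 - a / 2)%R (z - c2 - b / 2)%R.
Let hi (c1 c2 a b z : R) : R := Num.min (c1 + a / 2)%R (z - c2 + b / 2)%R.

(** [P] stands for a condition on z alone: the computation then covers both the product of two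
    intervals and the triset, where [P] says that z lies in the third interval. *)
Lemma centered_itv_fiber c1 c2 a b z (P : Prop) (E : set (RM * RM)) :
  (forall x, E (x, (z - x)%R) <-> P /\ centered_itv c1 a x /\ centered_itv c2 b (z - x)%R) -> P ->
  \int[lam]_x (\1_E (x, (z - x)%R) : R)%:E =
  (Num.max 0 (hi c1 c2 a b z - lo c1 c2 a b z))%R%:E.
Proof.
move=> EP p; transitivity (lam `](lo c1 c2 a b z), (hi c1 c2 a b z)[%classic).
  rewrite [RHS]integralTE//; apply: eq_integral => x _; rewrite !indicE; congr ((_ : bool)%:R)%:E.
  apply/idP/idP; rewrite !inE.
    move=> /EP[_ []]; rewrite /centered_itv /= !in_itv/= gt_max lt_min => /andP[h1 h2] /andP[h3 h4].
    by rewrite h1 h2/=; apply/andP; split; lra.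
  rewrite /= in_itv/= gt_max lt_min => /andP[/andP[h1 h2] /andP[h3 h4]].
  apply/EP; split => //; rewrite /centered_itv /= !in_itv/= h1 h3; split => //; apply/andP; split; lra.
rewrite lebesgue_measure_itv/= lte_fin; case: ltP => h.
  by rewrite -EFinB max_r// subr_ge0 ltW.
by rewrite max_l// subr_le0.
Qed.

(** The converse of [triset_le] for intervals. Shortening both intervals by t shortens the fiber
    over z from D to D - t. The first alternative makes D at least t over the third interval (or t =
    0), so nothing is lost there; the second makes the fibers of the shortened rectangle null
    outside it. *)
Lemma triset_centered_ge (c1 c2 a b c t : R) :
  (0 <= t)%R -> (t <= a)%R -> (t <= b)%R -> (0 <= c)%R ->
  t = 0%R \/ (c <= a + b - 2 * t)%R ->
  ((a - t) * (b - t) = 0 \/ a + b - 2 * t <= c)%R ->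
  (t * c + (a - t) * (b - t))%R%:E <=
  (lam \x lam) (triset (centered_itv c1 a) (centered_itv c2 b) (centered_itv (c1 + c2)%R c)).
Proof.
move=> t0 ta tb c0 P1 P2.
have mT : measurable (triset (centered_itv c1 a) (centered_itv c2 b) (centered_itv (c1 + c2)%R c) : set (RM * RM)).
  exact: measurable_triset.
have mX : measurable (centered_itv c1 (a - t)%R `*` centered_itv c2 (b - t)%R) by exact: measurableX.
rewrite EFinD (EFinM (a - t)%R).
rewrite -(@lam_centered_itv c1 (a - t)%R) ?subr_ge0// -(@lam_centered_itv c2 (b - t)%R) ?subr_ge0//.
rewrite -product_measure1E//.
rewrite EFinM -(@lam_centered_itv (c1 + c2)%R c)//.
suff : t%:E * lam (centered_itv (c1 + c2)%R c) + (lam \x lam) (centered_itv c1 (a - t)%R `*` centered_itv c2 (b - t)%R) <=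
  (lam \x lam) (triset (centered_itv c1 a) (centered_itv c2 b) (centered_itv (c1 + c2)%R c)) by [].
rewrite product_measure_shear1// product_measure_shear1// [lam _]integralTE//.
have mC := @measurable_indicE _ RM R _ (measurable_centered_itv (c1 + c2)%R c).
rewrite -ge0_integralZl//.
have mh : measurable_fun setT (fun z : RM => \int[lam]_x (\1_(centered_itv c1 (a - t)%R `*` centered_itv c2 (b - t)%R) (x, (z - x)%R) : R)%:E).
  apply: (@measurable_integral2 _ _ RM RM R lam (fun z x => (\1_(centered_itv c1 (a - t)%R `*` centered_itv c2 (b - t)%R) (x, (z - x)%R) : R)%:E)) => //.
  have mI : measurable_fun setT (fun p : RM * RM =>
      (\1_(centered_itv c1 (a - t)%R `*` centered_itv c2 (b - t)%R) p : R)%:E).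
    exact: measurable_indicE.
  apply: (measurableT_comp mI).
  by apply: measurable_fun_pair => //; exact: measurable_funB.
rewrite -ge0_integralD//; last 3 first.
- by move=> z _; rewrite mule_ge0// lee_fin.
- by apply: measurable_funeM.
- by move=> z _; exact: integral_ge0.
apply: integral_leT => z.
  by apply: adde_ge0; [rewrite mule_ge0// lee_fin|exact: integral_ge0].
rewrite (@centered_itv_fiber c1 c2 (a - t)%R (b - t)%R z True)//; last first.
  by move=> x; split => [[]|[_ []]].
have -> : hi c1 c2 (a - t)%R (b - t)%R z = (hi c1 c2 a b z - t / 2)%R.
  by rewrite /hi addr_minl; congr Num.min; lra.
have -> : lo c1 c2 (a - t)%R (b - t)%R z = (lo c1 c2 a b z + t / 2)%R.
  by rewrite /lo addr_maxl; congr Num.max; lra.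
have -> : (hi c1 c2 a b z - t / 2 - (lo c1 c2 a b z + t / 2) = hi c1 c2 a b z - lo c1 c2 a b z - t)%R by lra.
set D := (hi c1 c2 a b z - lo c1 c2 a b z)%R.
have [zC|zC] := pselect (centered_itv (c1 + c2)%R c z).
  rewrite [leRHS](@centered_itv_fiber c1 c2 a b z (centered_itv (c1 + c2)%R c z))//; last first.
    by move=> x; split=> [[/= h1 h2]|[h1 [h2 h3]]]; [rewrite subrKC|split => //=; rewrite subrKC].
  rewrite indicE mem_set// mule1 -EFinD lee_fin -/D.
  case: P1 => [->|P1]; first by rewrite subr0 add0r.
  suff tD : (t <= D)%R.
    rewrite max_r ?subr_ge0// max_r; last exact: le_trans t0 tD.
    by rewrite addrC subrK.
  move: zC; rewrite /centered_itv/= in_itv/= => /andP[h1 h2].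
  by rewrite /D /hi /lo; case: (leP (c1 - a / 2)%R (z - c2 - b / 2)%R) => h3; case: (leP (c1 + a / 2)%R (z - c2 + b / 2)%R) => h4; lra.
rewrite indicE memNset//= mule0 add0e max_l ?integral_ge0//.
rewrite /D /hi /lo; case: P2 => [/eqP|P2].
  rewrite mulf_eq0 => /orP[] /eqP h0;
  by case: (leP (c1 - a / 2)%R (z - c2 - b / 2)%R) => h3; case: (leP (c1 + a / 2)%R (z - c2 + b / 2)%R) => h4; lra.
have : ~~ ((c1 + c2 - c / 2 < z) && (z < c1 + c2 + c / 2))%R.
  by apply/negP => h; apply: zC; rewrite /centered_itv/= in_itv.
rewrite negb_and -!leNgt => /orP[] h;
by case: (leP (c1 - a / 2)%R (z - c2 - b / 2)%R) => h3; case: (leP (c1 + a / 2)%R (z - c2 + b / 2)%R) => h4; lra.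
Qed.

Lemma riesz_line (A B C : set RM) L (c1 c2 : R) :
  measurable A -> measurable B -> measurable C ->
  A `<=` `[(- L)%R, L]%classic -> B `<=` `[(- L)%R, L]%classic -> C `<=` `[(- L)%R, L]%classic ->
  (lam \x lam) (triset A B C) <=
  (lam \x lam) (triset (centered_itv c1 (fine (lam A))) (centered_itv c2 (fine (lam B)))
                       (centered_itv (c1 + c2)%R (fine (lam C)))).
Proof.
move=> mA mB mC AL BL CL.
have fA := lam_bounded mA AL; have fB := lam_bounded mB BL; have fC := lam_bounded mC CL.
set a := fine (lam A); set b := fine (lam B); set c := fine (lam C).
have aE : lam A = a%:E by rewrite /a fineK.
have bE : lam B = b%:E by rewrite /b fineK.
have cE : lam C = c%:E by rewrite /c fineK.
have a0 : (0 <= a)%R by rewrite fine_ge0.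
have b0 : (0 <= b)%R by rewrite fine_ge0.
have c0 : (0 <= c)%R by rewrite fine_ge0.
suff [t [t0 ta tb P1 P2]] : exists t, [/\ (0 <= t)%R, (t <= a)%R, (t <= b)%R,
    t = 0%R \/ (c <= a + b - 2 * t)%R & ((a - t) * (b - t) = 0 \/ a + b - 2 * t <= c)%R].
  apply: le_trans (triset_centered_ge c1 c2 t0 ta tb c0 P1 P2).
  apply: (le_trans (triset_le mA mB mC AL BL t0 _ _)); rewrite ?aE ?bE ?lee_fin//.
  by rewrite cE.
(* The value t = (a + b - c) / 2 gives c = a + b - 2t and meets both alternatives. It lies between 0
   and min(a, b) exactly when a, b, c satisfy the triangle inequalities; otherwise it is clamped to
   0, a or b. *)
have [h1|h1] := leP (a + b)%R c; first by exists 0%R; split => //; [left|right; lra].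
have [h2|h2] := leP (a + c)%R b.
  by exists a; split => //; [lra|right; lra|left; lra].
have [h3|h3] := leP (b + c)%R a.
  by exists b; split => //; [lra|right; lra|left; lra].
by exists ((a + b - c) / 2)%R; split; [lra|lra|lra|right; lra|right; lra].
Qed.

End riesz1_interval.

(** * Steiner symmetrization *)

Section steiner.
Local Open Scope ereal_scope.
Variables (R : realType) (m : nat).
Local Notation lam := (@lebesgue_measure R).
Local Notation RM := (measurableTypeR R).
Local Notation V := (borel_rV R m).
Local Notation W := (borel_rV R m.+1).
Local Notation mu := (muV R m.+1).
Implicit Types (A B C D K : set W) (u v w : 'rV[R]_m).

Definition dot u v : R := (\sum_i u 0 i * v 0 i)%R.

(* The parameter of the point of the line closest to 0. *)
Definition mid w u : R := (- dot u w / (1 + dot w w))%R.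

(** This matches the centers c1, c2 and c1 + c2 in [riesz_line] with the symmetrized sections over
    u, v and u + v. *)
Lemma midD w u v : mid w (u + v)%R = (mid w u + mid w v)%R.
Proof.
rewrite /mid -mulrDl -opprD; congr (- _ / _)%R.
by rewrite /dot -big_split/=; apply: eq_bigr => i _; rewrite mxE mulrDl.
Qed.

Lemma measurable_mid w : measurable_fun setT (mid w : V -> RM).
Proof.
apply: measurable_funM => //; apply: measurable_funN => //.
apply: measurable_sum => i; apply: measurable_funM => //.
exact: measurable_coord.
Qed.

Definition sec w A u : set RM := [set s | A (line w u s)].

Lemma measurable_sec w A u : measurable A -> measurable (sec w A u).
Proof.
by move=> mA; apply: (@measurable_preT _ _ _ _ (fun s : RM => line w u s)) => //; exact: measurable_line.
Qed.

Lemma lam_secE w A u : measurable A -> lam (sec w A u) = \int[lam]_s (\1_A (line w u s))%:E.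
Proof. by move=> mA; rewrite integralTE//; exact: measurable_sec. Qed.

Lemma measurable_lam_sec w A : measurable A ->
  measurable_fun setT ((fun u => lam (sec w A u)) : V -> \bar R).
Proof.
move=> mA; under eq_fun do rewrite lam_secE//.
apply: (@measurable_integral2 _ _ V RM R lam (fun u s => (\1_A (line w u s))%:E)) => //.
have mI : measurable_fun setT (fun x : W => (\1_A x : R)%:E) by exact: measurable_indicE.
by apply: (measurableT_comp mI); exact: measurable_line.
Qed.

Lemma muV_sec w A : measurable A -> mu A = \int[muV R m]_u lam (sec w A u).
Proof.
move=> mA; rewrite integralTE// (@ge0_integral_line _ _ w)//; last exact: measurable_indicE.
by apply: eq_integral => u _; rewrite lam_secE.
Qed.

(** Here s and u invert [line]. A section of infinite measure would be sent by [fine] to the empty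
    interval, hence the bound [coords_le] in the lemmas that follow the measure. *)
Definition steiner w A : set W :=
  [set x | let s := ((x : 'rV[R]_m.+1) 0 ord0)%R in
           let u := ((vtail x : 'rV[R]_m) - s *: w)%R in
           centered_itv (mid w u) (fine (lam (sec w A u))) s].

Lemma sec_steiner w A u :
  sec w (steiner w A) u = centered_itv (mid w u) (fine (lam (sec w A u))).
Proof.
have h s : (vtail (line w u s) : 'rV[R]_m) = (u + s *: w)%R.
  by apply/rowP => j; rewrite mxE vconsS.
by apply/seteqP; split => s; rewrite /sec /steiner /= vcons0 h addrK.
Qed.

Lemma measurable_steiner w A : measurable A -> measurable (steiner w A).
Proof.
move=> mA.
pose sf := fun x : W => ((x : 'rV[R]_m.+1) 0 ord0)%R : RM.
have ms : measurable_fun setT sf by exact: measurable_coord.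
pose uf := fun x : W => ((vtail x : 'rV[R]_m) - sf x *: w)%R : V.
have mt : measurable_fun setT (@vtail R m).
  by apply: measurable_rV => j; under eq_fun do rewrite mxE; exact: measurable_coord.
have mf : measurable_fun setT uf.
  by apply: measurable_subV => //; exact: measurable_scaleV.
have mc : measurable_fun setT (fun x => mid w (uf x) : RM).
  exact: (measurableT_comp (measurable_mid w)).
have ml : measurable_fun setT (fun x => fine (lam (sec w A (uf x))) : RM).
  apply: (measurableT_comp (@fine_measurable R setT measurableT)).
  exact: (measurableT_comp (measurable_lam_sec w mA)).
have ml2 : measurable_fun setT (fun x => (fine (lam (sec w A (uf x))) / 2)%R : RM).
  exact: measurable_funM.
rewrite (_ : steiner w A = (fun x : W => ((sf x - (mid w (uf x) - fine (lam (sec w A (uf x))) / 2))%R : RM)) @^-1` `]0%R, +oo[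
  `&` (fun x : W => (((mid w (uf x) + fine (lam (sec w A (uf x))) / 2) - sf x)%R : RM)) @^-1` `]0%R, +oo[); last first.
  apply/seteqP; split => x; rewrite /steiner /centered_itv/= !in_itv/= !subr_gt0 ?andbT.
    by move=> /andP[].
  by move=> [-> ->].
apply: measurableI; apply: measurable_preT => //.
  by apply: measurable_funB => //; exact: measurable_funB.
by apply: measurable_funB => //; exact: measurable_funD.
Qed.

Definition coords_le (L : R) : set W := [set x | forall i, (`|(x : 'rV[R]_m.+1) 0 i| <= L)%R].

Lemma sec_bounded w A L u : A `<=` coords_le L -> sec w A u `<=` `[(- L)%R, L]%classic.
Proof.
by move=> AL s /AL /(_ ord0); rewrite vcons0/= in_itv/= ler_norml.
Qed.

Lemma lam_sec_fin w A L u : measurable A -> A `<=` coords_le L -> lam (sec w A u) \is a fin_num.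
Proof.
move=> mA AL; apply: (@lam_bounded _ _ L); first exact: measurable_sec.
exact: sec_bounded.
Qed.

Lemma muV_steiner w A L : measurable A -> A `<=` coords_le L -> mu (steiner w A) = mu A.
Proof.
move=> mA AL; rewrite (muV_sec w); last exact: measurable_steiner.
rewrite [RHS](muV_sec w)//; apply: eq_integral => u _.
by rewrite sec_steiner lam_centered_itv ?fine_ge0// fineK//; exact: lam_sec_fin AL.
Qed.

Lemma measurable_trisetV A B C : measurable A -> measurable B -> measurable C ->
  measurable (triset (A : set 'rV[R]_m.+1) B C : set (W * W)).
Proof.
move=> mA mB mC.
rewrite (_ : triset _ _ _ = (fst @^-1` A `&` snd @^-1` B) `&`
   (fun p : W * W => ((p.1 : 'rV[R]_m.+1) + p.2)%R : W) @^-1` C); last first.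
  by apply/seteqP; split => [p [? ? ?]|p [[? ?] ?]].
apply: measurableI; first by apply: measurableI; apply: measurable_preT.
by apply: measurable_preT => //; exact: measurable_addV.
Qed.

Definition tri A B C : \bar R := (mu \x mu) (triset (A : set 'rV[R]_m.+1) B C).

(** Along the lines of direction (1, w) the functional is an integral over u and v of the
    one-dimensional functional of the sections over u, v and u + v, and [riesz_line] bounds each of
    them. *)
Lemma tri_steiner w A B C L :
  measurable A -> measurable B -> measurable C ->
  A `<=` coords_le L -> B `<=` coords_le L -> C `<=` coords_le L ->
  tri A B C <= tri (steiner w A) (steiner w B) (steiner w C).
Proof.
move=> mA mB mC AL BL CL.
have triE A' B' C' : measurable A' -> measurable B' -> measurable C' ->
    tri A' B' C' = \int[muV R m]_u \int[muV R m]_v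
      (lam \x lam) (triset (sec w A' u) (sec w B' v) (sec w C' (u + v)%R)).
  move=> mA' mB' mC'; rewrite /tri (@product_measure_line _ _ w); last exact: measurable_trisetV.
  apply: eq_integral => u _; apply: eq_integral => v _; congr ((_ \x _) _).
  by apply/seteqP; split => p [h1 h2 h3]; split => //; move: h3; rewrite /sec/= lineD.
rewrite (triE A B C)// (triE (steiner w A) (steiner w B) (steiner w C)); last 3 first.
- exact: measurable_steiner.
- exact: measurable_steiner.
- exact: measurable_steiner.
apply: integral_leT => u; first exact: integral_ge0.
apply: integral_leT => v; first exact: measure_ge0.
rewrite !sec_steiner midD; apply: (@riesz_line _ _ _ _ L).
- exact: measurable_sec.
- exact: measurable_sec.
- exact: measurable_sec.
- exact: sec_bounded.
- exact: sec_bounded.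
- exact: sec_bounded.
Qed.

(* What survives, for a line in any direction, of being a ball centered at 0. *)
Definition centered D := forall w u, exists l : R, [/\ (0 <= l)%R,
  centered_itv (mid w u) l `<=` sec w D u &
  sec w D u `<=` `[(mid w u - l / 2)%R, (mid w u + l / 2)%R]%classic].

Lemma centered_lam D w u : centered D -> measurable D ->
  centered_itv (mid w u) (fine (lam (sec w D u))) `<=` sec w D u /\
  lam (sec w D u) \is a fin_num.
Proof.
move=> cD mD; have [l [l0 h1 h2]] := cD w u.
suff -> : lam (sec w D u) = l%:E by [].
apply/eqP; rewrite eq_le; apply/andP; split.
  rewrite (@le_trans _ _ (lam `[(mid w u - l / 2)%R, (mid w u + l / 2)%R]%classic))//.
    by apply: le_mu => //; exact: measurable_sec.
  rewrite lebesgue_measure_itv/= lte_fin; case: ifPn => _; last by rewrite lee_fin.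
  by rewrite -EFinB lee_fin; lra.
rewrite -(@lam_centered_itv _ (mid w u) l l0); apply: le_mu => //.
  exact: measurable_centered_itv.
exact: measurable_sec.
Qed.

(** A section of A is no longer than that of K, and both are recentered at [mid]. With K a ball, all
    symmetrizations stay in one bounded set, so one gain constant serves at every step. *)
Lemma steiner_sub w A K : measurable A -> measurable K -> centered K ->
  A `<=` K -> steiner w A `<=` K.
Proof.
move=> mA mK cK AK x.
have [s [u ->]] : exists s u, x = line w u s.
  exists (((x : 'rV[R]_m.+1) 0 ord0)%R), ((vtail x : 'rV[R]_m) - ((x : 'rV[R]_m.+1) 0 ord0)%R *: w)%R.
  by rewrite /line subrK -[LHS]vunconsK.
have [h1 h2] := centered_lam w u cK mK.
move=> Sx; apply: h1; have : sec w (steiner w A) u s by [].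
rewrite sec_steiner /centered_itv /= !in_itv/=.
have : (fine (lam (sec w A u)) <= fine (lam (sec w K u)))%R.
  have AKl : lam (sec w A u) <= lam (sec w K u).
    by apply: le_mu; [exact: measurable_sec|exact: measurable_sec|move=> t /AK].
  apply: fine_le => //; rewrite ge0_fin_numE// (le_lt_trans AKl)// -ge0_fin_numE//.
by move=> h3 /andP[h4 h5]; apply/andP; split; lra.
Qed.

(** On each line let d and d' be the lengths of A \ D and D \ A. After symmetrization the sections
    of A and D share their midpoint, so what sticks out of D has length at most max(0, d - d') = d -
    min(d, d'). *)
Lemma steiner_decrease w A D L : measurable A -> measurable D -> centered D ->
  A `<=` coords_le L ->
  mu (steiner w A `\` D) + \int[muV R m]_u
     mine (lam (sec w (A `\` D) u)) (lam (sec w (D `\` A) u)) <= mu (A `\` D).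
Proof.
move=> mA mD cD AL.
have mS := measurable_steiner w mA.
have mAD : measurable (A `\` D) by exact: measurableD.
have mDA : measurable (D `\` A) by exact: measurableD.
have mSD : measurable (steiner w A `\` D) by exact: measurableD.
rewrite (muV_sec w mSD) (muV_sec w mAD) -ge0_integralD//; last 3 first.
- exact: measurable_lam_sec.
- by move=> u _; rewrite le_min !measure_ge0.
- by apply: measurable_mine; exact: measurable_lam_sec.
apply: integral_leT => u; first by rewrite adde_ge0// le_min !measure_ge0.
have [h1 h2] := centered_lam w u cD mD.
have msA := measurable_sec w u mA; have msD := measurable_sec w u mD.
have fA := lam_sec_fin w u mA AL.
set a := fine (lam (sec w A u)); set l := fine (lam (sec w D u)) in h1.
have lamA : lam (sec w A u) = a%:E by rewrite /a fineK.
have lamD : lam (sec w D u) = l%:E by rewrite /l fineK.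
have a0 : (0 <= a)%R by rewrite fine_ge0.
have l0 : (0 <= l)%R by rewrite fine_ge0.
have S1 : lam (sec w (steiner w A `\` D) u) <= (Num.max 0 (a - l))%R%:E.
  apply: (@le_trans _ _ (lam (centered_itv (mid w u) a `\` centered_itv (mid w u) l))).
    apply: le_mu; first exact: measurable_sec.
      by apply: measurableD; exact: measurable_centered_itv.
    move=> s [Ss Ds]; split; last by move=> /h1.
    by have : sec w (steiner w A) u s by []; rewrite sec_steiner.
  have [al|la] := leP a l.
    rewrite (_ : _ `\` _ = set0) ?measure0 ?lee_fin ?le_max ?lexx//.
    apply/seteqP; split => // s []; rewrite /centered_itv/= !in_itv/= => /andP[h3 h4] []; apply/andP; split; lra.
  rewrite measureD; [|exact: measurable_centered_itv|exact: measurable_centered_itv|].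
    rewrite (_ : _ `&` _ = centered_itv (mid w u) l); last first.
      apply/seteqP; split => s; first by case.
      rewrite /centered_itv/= !in_itv/= => /andP[h3 h4].
      by split; [apply/andP; split; lra|apply/andP].
    suff : lam (centered_itv (mid w u) a) - lam (centered_itv (mid w u) l) <= (Num.max 0 (a - l))%R%:E by [].
    by rewrite !lam_centered_itv// -EFinB lee_fin le_max lexx orbT.
  suff : lam (centered_itv (mid w u) a) < +oo by [].
  by rewrite lam_centered_itv// ltry.
have dA : a%:E = lam (sec w (A `\` D) u) + lam (sec w D u `&` sec w A u).
  by rewrite -lamA (measureDI lam msA msD); congr (_ + lam _); exact: setIC.
have dD : l%:E = lam (sec w (D `\` A) u) + lam (sec w D u `&` sec w A u).
  by rewrite -lamD (measureDI lam msD msA).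
(* Here z is the length of the common part, which cancels: a - l = d - d'. *)
suff H : forall x z d d' : \bar R, 0 <= x -> 0 <= d -> 0 <= d' -> 0 <= z ->
    x <= (Num.max 0 (a - l))%R%:E -> a%:E = d + z -> l%:E = d' + z -> x + mine d d' <= d.
  by apply: H S1 dA dD; exact: measure_ge0.
move=> x [z| |] [d| |] [d'| |]//; rewrite ?lee_fin// => x0 d0 d'0 z0 xle [aE] [lE].
case: x x0 xle => [x| |]//; rewrite !lee_fin => x0 xle.
rewrite -EFin_min -EFinD lee_fin; move: xle; rewrite aE lE.
by rewrite le_max => /orP[] h; case: (leP d d') => dd'; lra.
Qed.

End steiner.

(** * Balls, and the choice of a direction *)

Section balls.
Variables (R : realType) (m : nat).
Local Notation lam := (@lebesgue_measure R).
Local Notation RM := (measurableTypeR R).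
Implicit Types (x : 'rV[R]_m.+1) (u w : 'rV[R]_m).

Definition sumsq n (x : 'rV[R]_n) : R := \sum_i x 0 i ^+ 2.

Lemma sumsq_ge0 n (x : 'rV[R]_n) : 0 <= sumsq x.
Proof. by apply: sumr_ge0 => i _; exact: sqr_ge0. Qed.

Lemma enorm_le n (x : 'rV[R]_n) r : 0 <= r -> (enorm x <= r) = (sumsq x <= r ^+ 2).
Proof.
by move=> r0; rewrite -[in LHS](ger0_norm r0) -sqrtr_sqr ler_sqrt// sqr_ge0.
Qed.

Lemma enorm_lt n (x : 'rV[R]_n) r : 0 <= r -> (enorm x < r) = (sumsq x < r ^+ 2).
Proof.
move=> r0; rewrite -[in LHS](ger0_norm r0) -sqrtr_sqr.
move: r0; rewrite le_eqVlt => /predU1P[<-|r0]; last by rewrite ltr_sqrt// exprn_gt0.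
by rewrite expr0n/= sqrtr0 !ltNge sqrtr_ge0 sumsq_ge0.
Qed.

Lemma dotxx u : dot u u = sumsq u.
Proof. by apply: eq_bigr => i _; rewrite expr2. Qed.

(** Completing the square in s: this is why [mid] is the center of every section of a ball around
    0. *)
Lemma sumsq_line w u s : sumsq (line w u s : 'rV[R]_m.+1) =
  (1 + sumsq w) * (s - mid w u) ^+ 2 + (sumsq u - (1 + sumsq w) * mid w u ^+ 2).
Proof.
rewrite {1}/sumsq big_ord_recl vcons0/=.
under eq_bigr do rewrite vconsS/= 2!mxE.
have N0 : 1 + sumsq w != 0.
  by rewrite gt_eqF// (lt_le_trans ltr01)// lerDl sumsq_ge0.
have -> : \sum_i (u 0 i + s * w 0 i) ^+ 2 = sumsq u + 2 * s * dot u w + s ^+ 2 * sumsq w.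
  rewrite /sumsq /dot !mulr_sumr -!big_split/=; apply: eq_bigr => i _; ring.
have -> : dot u w = - ((1 + sumsq w) * mid w u).
  by rewrite /mid dotxx mulrC divfK// opprK.
ring.
Qed.

Lemma centered_sumsq (D : set (borel_rV R m.+1)) (c : R) :
  [set x | sumsq x < c] `<=` D -> D `<=` [set x | sumsq x <= c] ->
  centered D.
Proof.
move=> Dl Du w u.
have N0 : 0 < 1 + sumsq w.
  by rewrite (lt_le_trans ltr01)// lerDl sumsq_ge0.
(* The squared half-length of the section. It is negative when the line misses the ball; [Num.sqrt]
   then returns 0 and the open interval is empty. *)
pose q := (c - (sumsq u - (1 + sumsq w) * mid w u ^+ 2)) / (1 + sumsq w).
have lE s : sumsq (line w u s : 'rV[R]_m.+1) < c = ((s - mid w u) ^+ 2 < q).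
  by rewrite sumsq_line /q ltr_pdivlMr// ltrBrDr mulrC.
have leE s : sumsq (line w u s : 'rV[R]_m.+1) <= c = ((s - mid w u) ^+ 2 <= q).
  by rewrite sumsq_line /q ler_pdivlMr// lerBrDr mulrC.
have h2 : 2 * Num.sqrt q / 2 = Num.sqrt q by rewrite mulrC mulKf.
exists (2 * Num.sqrt q); split; first by rewrite mulr_ge0// sqrtr_ge0.
- move=> s; rewrite /centered_itv/= h2 in_itv/= => /andP[h3 h4].
  apply: Dl => /=; rewrite lE.
  have h5 : `|s - mid w u| < Num.sqrt q by rewrite ltr_norml; apply/andP; split; lra.
  have q0 : 0 < q by rewrite -sqrtr_gt0 (le_lt_trans _ h5).
  by move: h5; rewrite -sqrtr_sqr ltr_sqrt.
- move=> s /Du /=; rewrite leE => h3; rewrite h2 in_itv/=.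
  have : `|s - mid w u| <= Num.sqrt q by rewrite -sqrtr_sqr ler_wsqrtr.
  by rewrite ler_norml => /andP[h4 h5]; apply/andP; split; lra.
Qed.

Lemma measurable_sumsq n : measurable_fun setT (@sumsq n : borel_rV R n -> RM).
Proof.
apply: measurable_sum => i; apply: measurable_funX; exact: measurable_coord.
Qed.

(* The open ball of radius 0 is allowed, so that [ball0_exists] covers measure 0. *)
Definition ball0 n (D : set (borel_rV R n)) := exists2 r : R, 0 <= r &
  D = [set x | enorm (x : 'rV[R]_n) < r] \/ D = [set x | enorm (x : 'rV[R]_n) <= r].

Lemma ball0_sumsq n (D : set (borel_rV R n)) : ball0 D -> exists2 r : R, 0 <= r &
  D = [set x | sumsq (x : 'rV[R]_n) < r ^+ 2] \/ D = [set x | sumsq (x : 'rV[R]_n) <= r ^+ 2].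
Proof.
move=> [r r0 DE]; exists r => //.
by case: DE => ->; [left|right]; apply/seteqP; split => x /=; rewrite ?enorm_lt ?enorm_le.
Qed.

Lemma ball0_measurable n (D : set (borel_rV R n)) : ball0 D -> measurable D.
Proof.
move=> /ball0_sumsq[r _ [] ->].
  rewrite (_ : [set x | _] = @sumsq n @^-1` `]-oo, (r ^+ 2)[%classic); last first.
    by apply/seteqP; split => x /=; rewrite in_itv.
  exact: (measurable_preT (@measurable_sumsq n)).
rewrite (_ : [set x | _] = @sumsq n @^-1` `]-oo, (r ^+ 2)]%classic); last first.
  by apply/seteqP; split => x /=; rewrite in_itv.
exact: (measurable_preT (@measurable_sumsq n)).
Qed.

Lemma ball0_centered (D : set (borel_rV R m.+1)) : ball0 D -> centered D.
Proof.
move=> /ball0_sumsq[r _ DE]; apply: (@centered_sumsq _ (r ^+ 2)).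
  by case: DE => -> x //= /ltW.
by case: DE => -> x //= /ltW.
Qed.

Lemma sumsq_coord n (x : 'rV[R]_n) (r : R) : 0 <= r -> sumsq x <= r ^+ 2 -> forall i, `|x 0 i| <= r.
Proof.
move=> r0 h i; rewrite -(@ler_pXn2r _ 2)// ?nnegrE// real_normK ?num_real//.
by apply: le_trans h; rewrite /sumsq (bigD1 i)//= lerDl sumr_ge0// => j _; exact: sqr_ge0.
Qed.

Lemma ball0_coords (D : set (borel_rV R m.+1)) : ball0 D -> exists2 L, 0 <= L & D `<=` coords_le L.
Proof.
move=> /ball0_sumsq[r r0 DE]; exists r => // x Dx.
by apply: sumsq_coord => //; case: DE Dx => -> /= // /ltW.
Qed.

End balls.

(** * Averaging the overlap of sections over directions *)

Section direction.
Local Open Scope ereal_scope.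
Variables (R : realType) (m : nat).
Local Notation lam := (@lebesgue_measure R).
Local Notation RM := (measurableTypeR R).
Local Notation V := (borel_rV R m).
Local Notation W := (borel_rV R m.+1).

(** Closed, unlike the half-open [cube], so as to contain the sets bounded by [coords_le]. *)
Definition icube (L : R) : set V := vprod (fun=> `[(- L)%R, L]%classic).

Lemma measurable_icube L : measurable (icube L).
Proof. by apply: measurable_vprod => i; exact: measurable_itv. Qed.

Lemma muV_icube L : (0 < L)%R -> muV R m (icube L) = ((2 * L) ^+ m)%R%:E.
Proof.
move=> L0; rewrite muV_vprod//.
rewrite (eq_bigr (fun=> (2 * L)%R%:E)); last first.
  move=> i _; rewrite lebesgue_measure_itv/= lte_fin; case: ltP => h; last by congr EFin; lra.
  by rewrite -EFinB; congr EFin; lra.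
by rewrite prodEFin prodr_const card_ord.
Qed.

Lemma icubeP L (x : 'rV[R]_m) : icube L x <-> forall i, (`|x 0%R i| <= L)%R.
Proof. by split => h i; have := h i; rewrite /= in_itv/= ler_norml. Qed.

Variables (D1 D2 : set W) (L : R).
Hypotheses (mD1 : measurable D1) (mD2 : measurable D2) (L0 : (0 < L)%R)
  (D1L : D1 `<=` coords_le L) (D2L : D2 `<=` coords_le L).

Let g1 (s : RM) (x : V) : R := \1_D1 (vcons (s, x)).
Let g2 (s : RM) (x : V) : R := \1_D2 (vcons (s, x)).

Let mg1 d (T : measurableType d) (f : T -> RM) (g : T -> V) :
  measurable_fun setT f -> measurable_fun setT g ->
  measurable_fun setT (fun t => g1 (f t) (g t) : RM).
Proof.
move=> mf mg.
have mI : measurable_fun setT (fun x : W => \1_D1 x : R) by exact: measurable_indic.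
apply: (measurableT_comp mI).
by apply: (measurableT_comp (@measurable_vcons R m)); exact: measurable_fun_pair.
Qed.

Let mg2 d (T : measurableType d) (f : T -> RM) (g : T -> V) :
  measurable_fun setT f -> measurable_fun setT g ->
  measurable_fun setT (fun t => g2 (f t) (g t) : RM).
Proof.
move=> mf mg.
have mI : measurable_fun setT (fun x : W => \1_D2 x : R) by exact: measurable_indic.
apply: (measurableT_comp mI).
by apply: (measurableT_comp (@measurable_vcons R m)); exact: measurable_fun_pair.
Qed.

Let g1_ge0 s x : (0 <= g1 s x)%R. Proof. by rewrite /g1 indicE ler0n. Qed.
Let g2_ge0 s x : (0 <= g2 s x)%R. Proof. by rewrite /g2 indicE ler0n. Qed.

(** The integrand after the substitution x = u + s w: the slice of D1 no longer depends on w, so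
    averaging over w affects the slice of D2 only. *)
Let fF (w : V) (s s' : RM) (x : V) : \bar R :=
  (g1 s x * g2 s' ((x : 'rV[R]_m) + (s' - s) *: w))%R%:E.

Let mfF d (T : measurableType d) (f1 : T -> V) (f2 f3 : T -> RM) (f4 : T -> V) :
  measurable_fun setT f1 -> measurable_fun setT f2 ->
  measurable_fun setT f3 -> measurable_fun setT f4 ->
  measurable_fun setT (fun t => fF (f1 t) (f2 t) (f3 t) (f4 t)).
Proof.
move=> m1 m2 m3 m4; apply/measurable_EFinP; apply: measurable_funM; first exact: mg1.
apply: mg2 => //; apply: measurable_addV => //; apply: measurable_scaleV => //.
exact: measurable_funB.
Qed.

Let fF_ge0 w s s' x : 0 <= fF w s s' x.
Proof. by rewrite lee_fin mulr_ge0. Qed.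

(** A product replaces the minimum of [steiner_decrease] because Tonelli can expand it. The minimum
    is recovered in [steiner_gain]: lengths x, y at most 2L satisfy x y <= 2L min(x, y). *)
Definition section_overlap w := \int[muV R m]_u (lam (sec w D1 u) * lam (sec w D2 u)).

Let section_overlapE (w : V) :
  section_overlap w = \int[lam]_s \int[lam]_s' \int[muV R m]_x fF w s s' x.
Proof.
pose h u s s' := (g1 s ((u : 'rV[R]_m) + s *: (w : 'rV[R]_m)) * g2 s' ((u : 'rV[R]_m) + s' *: (w : 'rV[R]_m)))%R%:E : \bar R.
have h0 u s s' : 0 <= h u s s' by rewrite lee_fin mulr_ge0.
have mh d (T : measurableType d) (f1 : T -> V) (f2 f3 : T -> RM) :
    measurable_fun setT f1 -> measurable_fun setT f2 -> measurable_fun setT f3 ->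
    measurable_fun setT (fun t => h (f1 t) (f2 t) (f3 t)).
  move=> m1 m2 m3; apply/measurable_EFinP; apply: measurable_funM; [apply: mg1 => //|apply: mg2 => //];
    by apply: measurable_addV => //; exact: measurable_scaleV.
transitivity (\int[muV R m]_u \int[lam]_s \int[lam]_s' h u s s').
  apply: eq_integral => u _; rewrite !lam_secE//.
  rewrite -ge0_integralZr//; last 2 first.
  - have mI : measurable_fun setT (fun x : W => \1_D1 x : R) by exact: measurable_indic.
    by apply/measurable_EFinP; apply: (measurableT_comp mI); exact: measurable_line.
  - by apply: integral_ge0 => s _; rewrite lee_fin.
  apply: eq_integral => s _; rewrite -ge0_integralZl//.
  have mI : measurable_fun setT (fun x : W => \1_D2 x : R) by exact: measurable_indic.
  by apply/measurable_EFinP; apply: (measurableT_comp mI); exact: measurable_line.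
rewrite (@integral_swap _ _ V RM R (muV R m) lam (fun u s => \int[lam]_s' h u s s')); last 2 first.
- apply: (@measurable_integral2 _ _ (V * RM)%type RM R lam (fun p s' => h p.1 p.2 s')) => //.
  by apply: mh => //; exact: measurableT_comp.
- by move=> u s; exact: integral_ge0.
apply: eq_integral => s _.
rewrite (@integral_swap _ _ V RM R (muV R m) lam (fun u s' => h u s s')); last 2 first.
- exact: mh.
- by move=> u s'.
apply: eq_integral => s' _.
rewrite -(@ge0_integral_muV_shift _ _ (s *: (w : 'rV[R]_m))%R (fun x => fF w s s' x)); last 2 first.
- exact: mfF.
- by move=> x.
  apply: eq_integral => u _; rewrite /h /fF; congr ((_ * g2 _ _)%R)%:E.
  by rewrite -addrA -scalerDl subrKC.
Qed.

Let p2 s' : \bar R := \int[muV R m]_y (g2 s' y)%:E.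

Let p2_ge0 s' : 0 <= p2 s'.
Proof. by apply: integral_ge0 => y _; rewrite lee_fin. Qed.

Let k := ((2 * L) ^+ m)%R.
Let k_gt0 : (0 < k)%R. Proof. by rewrite exprn_gt0// mulr_gt0. Qed.

Let in_D1 s x : g1 s x != 0%R -> (`|s| <= L)%R /\ icube L x.
Proof.
rewrite /g1 indicE; have [|_ /eqP//] := boolP (vcons (s, x) \in D1).
rewrite inE => /D1L D _; split; first by have := D ord0; rewrite vcons0.
by apply/icubeP => i; have := D (lift ord0 i); rewrite vconsS.
Qed.

Let in_D2 s x : g2 s x != 0%R -> (`|s| <= L)%R /\ icube L x.
Proof.
rewrite /g2 indicE; have [|_ /eqP//] := boolP (vcons (s, x) \in D2).
rewrite inE => /D2L D _; split; first by have := D ord0; rewrite vcons0.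
by apply/icubeP => i; have := D (lift ord0 i); rewrite vconsS.
Qed.

Let p2_le s' : p2 s' <= k%:E.
Proof.
rewrite -muV_icube// integralTE; last exact: measurable_icube.
apply: integral_leT => y; rewrite lee_fin// indicE.
have [->|/in_D2[_ h]] := eqVneq (g2 s' y) 0%R; first by rewrite ler0n.
by rewrite mem_set// /g2 indicE; case: (_ \in _).
Qed.

Variables (e : R).
Hypothesis e_gt0 : (0 < e)%R.
(** Two points of the sets at heights differing by at least e are joined only by a direction w with
    coordinates at most 2L / e, so restricting w to this cube loses none of these pairs. *)
Let Q := icube (2 * L / e)%R.
Let fQ (w : V) (s s' : RM) (x : V) : \bar R := (\1_Q w)%:E * fF w s s' x.

Let fQ_ge0 w s s' x : 0 <= fQ w s s' x.
Proof. by rewrite mule_ge0// lee_fin. Qed.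

Let mfQ d (T : measurableType d) (f1 : T -> V) (f2 f3 : T -> RM) (f4 : T -> V) :
  measurable_fun setT f1 -> measurable_fun setT f2 ->
  measurable_fun setT f3 -> measurable_fun setT f4 ->
  measurable_fun setT (fun t => fQ (f1 t) (f2 t) (f3 t) (f4 t)).
Proof.
move=> m1 m2 m3 m4; apply: emeasurable_funM; last exact: mfF.
apply/measurable_EFinP; apply: (measurableT_comp _ m1).
by apply: measurable_indic; exact: measurable_icube.
Qed.

Let overlap_swap : \int[muV R m]_w ((\1_Q w)%:E * section_overlap w) =
  \int[lam]_s \int[lam]_s' \int[muV R m]_x \int[muV R m]_w fQ w s s' x.
Proof.
transitivity (\int[muV R m]_w \int[lam]_s \int[lam]_s' \int[muV R m]_x fQ w s s' x).
  apply: eq_integral => w _; rewrite section_overlapE /fQ indicE.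
  case: (w \in Q).
    rewrite mul1e; apply: eq_integral => s _; apply: eq_integral => s' _.
    by apply: eq_integral => x _; rewrite mul1e.
  rewrite mul0e; apply/esym; apply: integral0_eq => s _; apply: integral0_eq => s' _.
  by apply: integral0_eq => x _; rewrite mul0e.
rewrite (@integral_swap _ _ V RM R (muV R m) lam (fun w s => \int[lam]_s' \int[muV R m]_x fQ w s s' x)); last 2 first.
- apply: (@measurable_integral2 _ _ (V * RM)%type RM R lam (fun p s' => \int[muV R m]_x fQ p.1 p.2 s' x)) => [|p s']; last exact: integral_ge0.
  apply: (@measurable_integral2 _ _ ((V * RM) * RM)%type V R (muV R m) (fun p x => fQ p.1.1 p.1.2 p.2 x)) => //.
  by apply: mfQ; do ?[exact: measurable_fst|exact: measurable_snd|exact: measurable_cst|apply: measurableT_comp].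
- by move=> w s; apply: integral_ge0 => s' _; exact: integral_ge0.
apply: eq_integral => s _.
rewrite (@integral_swap _ _ V RM R (muV R m) lam (fun w s' => \int[muV R m]_x fQ w s s' x)); last 2 first.
- apply: (@measurable_integral2 _ _ (V * RM)%type V R (muV R m) (fun p x => fQ p.1 s p.2 x)) => //.
  by apply: mfQ; do ?[exact: measurable_fst|exact: measurable_snd|exact: measurable_cst|apply: measurableT_comp].
- by move=> w s'; exact: integral_ge0.
apply: eq_integral => s' _.
rewrite (@integral_swap _ _ V V R (muV R m) (muV R m) (fun w x => fQ w s s' x)); [by []|exact: mfQ|by move=> w x].
Qed.

(** The change of variables from w to x + (s' - s) w costs the factor |s' - s|^m, which is at most
    (2L)^m = k once both heights are in [-L, L]; otherwise one of the slices is empty. *)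
Let overlap_inner s s' x : (e <= `|s' - s|)%R ->
  (k^-1 * g1 s x)%R%:E * p2 s' <= \int[muV R m]_w fQ w s s' x.
Proof.
move=> ess.
have [->|g10] := eqVneq (g1 s x) 0%R.
  by rewrite mulr0 mul0e; exact: integral_ge0.
have g11 : g1 s x = 1%R by move: g10; rewrite /g1 indicE; case: (_ \in _) => // /eqP.
have [sL xL] := in_D1 g10.
have [s'L|Ls'] := leP `|s'|%R L; last first.
  rewrite /p2 integral0_eq ?mule0; first exact: integral_ge0.
  move=> y _; congr EFin; apply/eqP; apply/negPn/negP => /in_D2[h _].
  by move: Ls'; rewrite ltNge h.
set r := (s' - s)%R in ess *.
have r0 : (0 < `|r|)%R by exact: lt_le_trans ess.
have r0' : r != 0%R by rewrite -normr_gt0.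
have rL : (`|r| <= 2 * L)%R.
  by apply: (le_trans (ler_normB _ _)); lra.
have mg d (T : measurableType d) (f : T -> V) : measurable_fun setT f ->
    measurable_fun setT (fun t => (g2 s' (f t))%:E).
  by move=> mf; apply/measurable_EFinP; exact: mg2.
have -> : \int[muV R m]_w fQ w s s' x =
    \int[muV R m]_w (g2 s' (r *: (w : 'rV[R]_m) + x))%R%:E.
  apply: eq_integral => w _; rewrite /fQ /fF -/r g11 mul1r -EFinM; congr EFin.
  rewrite [in RHS]addrC.
  have [->|/in_D2[_ h]] := eqVneq (g2 s' ((x : 'rV[R]_m) + r *: (w : 'rV[R]_m))%R) 0%R;
    first by rewrite mulr0.
  rewrite indicE mem_set ?mul1r//; apply/icubeP => i.
  move/icubeP : xL => /(_ i) xi; move/icubeP : h => /(_ i); rewrite !mxE => hi.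
  have rw : (`|r| * `|(w : 'rV[R]_m) ord0 i| <= 2 * L)%R.
    rewrite -normrM; have -> : (r * (w : 'rV[R]_m) ord0 i = ((x : 'rV[R]_m) ord0 i + r * (w : 'rV[R]_m) ord0 i) - (x : 'rV[R]_m) ord0 i)%R by ring.
    apply: (le_trans (ler_normB _ _)); move: xi hi.
    by set t1 := `|_|%R; set t2 := `|_|%R => ? ?; lra.
  rewrite ler_pdivlMr// mulrC (le_trans _ rw)//.
  by rewrite ler_wpM2r.
rewrite /p2 (@ge0_integral_muV_affine _ _ r x)//; last 2 first.
- exact: mg.
- by move=> y; rewrite lee_fin.
rewrite muleA g11 mulr1 -EFinM.
rewrite -[leRHS]mul1e; apply: lee_wpmul2r.
  by apply: integral_ge0 => w _; rewrite lee_fin.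
rewrite lee_fin mulrC ler_pdivrMr// mul1r /k.
by rewrite lerXn2r// nnegrE// mulr_ge0// ltW.
Qed.

Let G1 s : \bar R := \int[muV R m]_x (k^-1 * g1 s x)%R%:E.

Let G1_ge0 s : 0 <= G1 s.
Proof. by apply: integral_ge0 => x _; rewrite lee_fin mulr_ge0// invr_ge0 ltW. Qed.

Let mkg1 d (T : measurableType d) (f2 : T -> RM) (f4 : T -> V) :
  measurable_fun setT f2 -> measurable_fun setT f4 ->
  measurable_fun setT (fun t => (k^-1 * g1 (f2 t) (f4 t))%R%:E).
Proof.
by move=> m2 m4; apply/measurable_EFinP; apply: measurable_funM => //; exact: mg1.
Qed.

Let mG1 : measurable_fun setT G1.
Proof.
apply: (@measurable_integral2 _ _ RM V R (muV R m) (fun s x => (k^-1 * g1 s x)%R%:E)).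
  exact: mkg1.
by move=> s x; rewrite lee_fin mulr_ge0// invr_ge0 ltW.
Qed.

Let mp2 : measurable_fun setT p2.
Proof.
apply: (@measurable_integral2 _ _ RM V R (muV R m) (fun s x => (g2 s x)%R%:E)).
  by apply/measurable_EFinP; exact: mg2.
by move=> s x; rewrite lee_fin.
Qed.

Let int_p2 : \int[lam]_s p2 s = muV R m.+1 D2.
Proof.
rewrite integralTE// ge0_integral_muVS//; exact: measurable_indicE.
Qed.

Let int_G1 : \int[lam]_s G1 s = (k^-1)%:E * muV R m.+1 D1.
Proof.
rewrite integralTE// ge0_integral_muVS//; last exact: measurable_indicE.
have mg d (T : measurableType d) (f2 : T -> RM) (f4 : T -> V) :
    measurable_fun setT f2 -> measurable_fun setT f4 ->
    measurable_fun setT (fun t => (g1 (f2 t) (f4 t))%:E).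
  by move=> m2 m4; apply/measurable_EFinP; exact: mg1.
rewrite -ge0_integralZl; [|exact: measurableT| | |]; last 3 first.
- apply: (@measurable_integral2 _ _ RM V R (muV R m) (fun s x => (g1 s x)%R%:E)).
    exact: mg.
  by move=> s x; rewrite lee_fin.
- by move=> s _; apply: integral_ge0 => x _; rewrite lee_fin.
- by rewrite lee_fin invr_ge0 ltW.
apply: eq_integral => s _.
rewrite -ge0_integralZl; [by []|exact: measurableT|exact: mg| |].
- by move=> x _; rewrite lee_fin.
- by rewrite lee_fin invr_ge0 ltW.
Qed.

(* For sections at heights s and s' with |s' - s| >= e, substitute
   y = x + (s' - s) w in the integral over w; the other pairs (s, s') account
   for the last term. *)
Lemma overlap_average : (k^-1)%:E * muV R m.+1 D1 * muV R m.+1 D2 <=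
  \int[muV R m]_w ((\1_Q w)%:E * section_overlap w) +
  (k^-1)%:E * muV R m.+1 D1 * (k * (2 * e))%R%:E.
Proof.
rewrite -int_G1 -int_p2 overlap_swap.
(* For heights closer than e the joining directions are unbounded. These pairs are given up: a slice
   has measure at most k and the heights fill an interval of length 2e, whence the error k * 2e. *)
pose N s : set RM := `](s - e)%R, (s + e)%R[%classic.
have mNs s : measurable (N s) by exact: measurable_itv.
have NE s : lam (N s) = (2 * e)%R%:E.
  rewrite lebesgue_measure_itv/= lte_fin; case: ltP => h; last by congr EFin; move: e_gt0 h => ? ?; lra.
  by rewrite -EFinB; congr EFin; lra.
rewrite -ge0_integralZr//; last exact: integral_ge0.
rewrite -ge0_integralZr//; last by rewrite lee_fin mulr_ge0 ?mulr_ge0// ltW.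
rewrite -ge0_integralD//; last 4 first.
- by move=> s _; do 3 apply: integral_ge0 => ? _.
- apply: (@measurable_integral2 _ _ RM RM R lam (fun s s' => \int[muV R m]_x \int[muV R m]_w fQ w s s' x)) => [|s s']; last by do 2 apply: integral_ge0 => ? _.
  apply: (@measurable_integral2 _ _ (RM * RM)%type V R (muV R m) (fun p x => \int[muV R m]_w fQ w p.1 p.2 x)) => [|s x]; last exact: integral_ge0.
  apply: (@measurable_integral2 _ _ ((RM * RM) * V)%type V R (muV R m) (fun p w => fQ w p.1.1 p.1.2 p.2)) => //.
  by apply: mfQ; do ?[exact: measurable_fst|exact: measurable_snd|exact: measurable_cst|apply: measurableT_comp].
- by move=> s _; rewrite mule_ge0// lee_fin mulr_ge0 ?mulr_ge0// ltW.
- exact: emeasurable_funM.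
apply: integral_leT => s; first by rewrite mule_ge0//; exact: integral_ge0.
have -> : (k * (2 * e))%R%:E = \int[lam]_s' (k%:E * (\1_(N s) s')%:E).
  rewrite ge0_integralZl; [|exact: measurableT|exact: measurable_indicE (mNs s)| |]; last 2 first.
  - by move=> s' _; rewrite lee_fin.
  - by rewrite lee_fin ltW.
  by rewrite EFinM -(NE s); congr (_ * _); rewrite integralTE.
have mN : measurable_fun setT (fun s' : RM => k%:E * (\1_(N s) s' : R)%:E).
  by apply: measurable_funeM; exact: measurable_indicE (mNs s).
have N0 s' : 0 <= k%:E * (\1_(N s) s' : R)%:E.
  by rewrite mule_ge0// lee_fin ltW.
rewrite -ge0_integralZl; [|exact: measurableT|exact: mp2|by move=> s' _|exact: G1_ge0].
rewrite -ge0_integralZl; [|exact: measurableT|exact: mN|by move=> s' _|exact: G1_ge0].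
rewrite -ge0_integralD; [|exact: measurableT| | | |]; last 4 first.
- by move=> s' _; do 2 apply: integral_ge0 => ? _.
- apply: (@measurable_integral2 _ _ RM V R (muV R m) (fun s' x => \int[muV R m]_w fQ w s s' x)) => [|s' x]; last exact: integral_ge0.
  apply: (@measurable_integral2 _ _ (RM * V)%type V R (muV R m) (fun p w => fQ w s p.1 p.2)) => //.
  by apply: mfQ; do ?[exact: measurable_fst|exact: measurable_snd|exact: measurable_cst|apply: measurableT_comp].
- by move=> s' _; rewrite mule_ge0.
- exact: measurable_funeM.
apply: integral_leT => s'; first by rewrite mule_ge0.
have [ess|ess] := leP e `|s' - s|%R.
  apply: (@le_trans _ _ (\int[muV R m]_x \int[muV R m]_w fQ w s s' x)); last first.
    by rewrite leeDl// mule_ge0.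
  rewrite /G1 -ge0_integralZr; [|exact: measurableT|exact: mkg1| |exact: p2_ge0]; last first.
    by move=> x _; rewrite lee_fin mulr_ge0// invr_ge0 ltW.
  apply: integral_leT => x; last exact: overlap_inner.
  by rewrite mule_ge0// lee_fin mulr_ge0// invr_ge0 ltW.
rewrite (@le_trans _ _ (G1 s * (k%:E * (\1_(N s) s')%:E)))//; last first.
  by rewrite leeDr//; do 2 apply: integral_ge0 => ? _.
rewrite indicE mem_set ?mule1; last first.
  by rewrite /N/= in_itv/=; move: ess; rewrite ltr_norml => /andP[h1 h2]; apply/andP; split; lra.
by apply: lee_wpmul2l.
Qed.

End direction.

(** * The Riesz inequality in R^d *)

Section riesz.
Local Open Scope ereal_scope.
Variables (R : realType) (m : nat).
Local Notation lam := (@lebesgue_measure R).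
Local Notation RM := (measurableTypeR R).
Local Notation V := (borel_rV R m).
Local Notation W := (borel_rV R m.+1).
Local Notation mu := (muV R m.+1).
Implicit Types (A B C D K : set W).

Lemma bounded_fin A L : (0 < L)%R -> measurable A -> A `<=` coords_le L -> mu A \is a fin_num.
Proof.
move=> L0 mA AL; rewrite ge0_fin_numE//.
apply: (@le_lt_trans _ _ (mu (icube L))).
  apply: le_mu => //; first exact: measurable_icube.
  by move=> x /AL h; apply/icubeP.
by rewrite muV_icube// ltry.
Qed.

(** If every direction had a small overlap, so would the average. The quantifier order matters:
    kappa depends on L and eta only, while the sets change at each symmetrization. *)
Lemma exists_direction (L eta : R) : (0 < L)%R -> (0 < eta)%R ->
  exists2 kappa : R, (0 < kappa)%R & forall D1 D2,
    measurable D1 -> measurable D2 -> D1 `<=` coords_le L -> D2 `<=` coords_le L ->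
    eta%:E <= mu D1 -> eta%:E <= mu D2 ->
    exists w : 'rV[R]_m, kappa%:E <= section_overlap D1 D2 w.
Proof.
move=> L0 eta0; pose k := ((2 * L) ^+ m)%R.
have k0 : (0 < k)%R by rewrite exprn_gt0// mulr_gt0.
(* Makes the error factor k * 2e equal to eta / 2, half of the least value of the measure of D2. The
   averaged overlap is then at least k^-1 eta^2 / 2. *)
pose e := (eta / (4 * k))%R.
have e0 : (0 < e)%R by rewrite divr_gt0// mulr_gt0.
have Le0 : (0 < 2 * L / e)%R by rewrite divr_gt0// mulr_gt0.
pose q := ((2 * (2 * L / e)) ^+ m)%R.
have q0 : (0 < q)%R by rewrite exprn_gt0// mulr_gt0.
(* Times the volume q of the cube of directions this is k^-1 eta^2 / 4, half of the lower bound for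
   the averaged overlap. *)
exists (k^-1 * eta ^+ 2 / (4 * q))%R.
  by rewrite divr_gt0// mulr_gt0// ?invr_gt0// exprn_gt0.
move=> D1 D2 mD1 mD2 D1L D2L P1 P2.
apply: contrapT => /forallNP h.
have := overlap_average mD1 mD2 L0 D1L D2L e0.
rewrite -/k.
have f1 := bounded_fin L0 mD1 D1L; have f2 := bounded_fin L0 mD2 D2L.
have -> : mu D1 = (fine (mu D1))%:E by rewrite fineK.
have -> : mu D2 = (fine (mu D2))%:E by rewrite fineK.
move: P1 P2; rewrite -(fineK f1) -(fineK f2) !lee_fin.
set p1 := fine _; set p2 := fine _ => P1 P2.
apply/negP; rewrite -ltNge.
apply: (@le_lt_trans _ _ ((k^-1 * eta ^+ 2 / 4)%R%:E + (k^-1)%:E * p1%:E * (k * (2 * e))%R%:E)).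
  apply: leeD2r.
  have -> : (k^-1 * eta ^+ 2 / 4 = (k^-1 * eta ^+ 2 / (4 * q)) * q)%R.
    by field; rewrite !gt_eqF//.
  rewrite EFinM -[q%:E](@muV_icube R m)// integralTE; last exact: measurable_icube.
  rewrite -ge0_integralZl; [|exact: measurableT| |by move=> x _; rewrite lee_fin|]; last 2 first.
  - by apply: measurable_indicE; exact: measurable_icube.
  - by rewrite lee_fin ltW// divr_gt0// mulr_gt0// ?invr_gt0// exprn_gt0.
  apply: integral_leT => w.
    by rewrite mule_ge0 ?lee_fin//; apply: integral_ge0 => u _; rewrite mule_ge0.
  rewrite muleC lee_wpmul2r ?lee_fin//.
  by have /negP := h w; rewrite -ltNge => /ltW.
rewrite -!EFinM -EFinD lte_fin.
have -> : (k * (2 * e) = eta / 2)%R by rewrite /e; field; rewrite gt_eqF.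
rewrite -!mulrA -mulrDr ltr_pM2l ?invr_gt0//.
have h1 : (p1 * eta <= p1 * p2)%R by rewrite ler_wpM2l// (le_trans (ltW eta0)).
have h2 : (eta * eta <= p1 * eta)%R by rewrite ler_wpM2r// ltW.
have h3 : (0 < eta * eta)%R by rewrite mulr_gt0.
by move=> /=; lra.
Qed.

Lemma steiner_gain (L eta : R) : (0 < L)%R -> (0 < eta)%R ->
  exists2 kappa : R, (0 < kappa)%R & forall A D,
    measurable A -> measurable D -> centered D ->
    A `<=` coords_le L -> D `<=` coords_le L -> mu A <= mu D ->
    eta%:E <= mu (A `\` D) ->
    exists w : 'rV[R]_m, mu (steiner w A `\` D) + kappa%:E <= mu (A `\` D).
Proof.
move=> L0 eta0; have [kap kap0 H] := exists_direction L0 eta0.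
exists (kap / (2 * L))%R; first by rewrite divr_gt0// mulr_gt0.
move=> A D mA mD cD AL DL AD eA.
have mAD : measurable (A `\` D) by exact: measurableD.
have mDA : measurable (D `\` A) by exact: measurableD.
have ADL : A `\` D `<=` coords_le L by move=> x [/AL].
have DAL : D `\` A `<=` coords_le L by move=> x [/DL].
have fI : mu (A `&` D) \is a fin_num.
  by apply: (bounded_fin L0); [exact: measurableI|move=> x [/AL]].
(* As A has at most the measure of D, cancelling the finite common part shows that D \ A is at least
   as large as A \ D. *)
have eD : eta%:E <= mu (D `\` A).
  apply: (le_trans eA); move: AD; rewrite (measureDI _ mA mD) (measureDI _ mD mA).
  by rewrite [X in _ + mu X <= _]setIC leeD2rE// setIC.
have [w Hw] := H _ _ mAD mDA ADL DAL eA eD.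
exists w; apply: le_trans (steiner_decrease w mA mD cD AL); apply: leeD2l.
have L20 : (0 < (2 * L)^-1)%R by rewrite invr_gt0 mulr_gt0.
have secle B : measurable B -> B `<=` coords_le L -> forall u, lam (sec w B u) <= (2 * L)%R%:E.
  move=> mB BL u; apply: (@le_trans _ _ (lam `[(- L)%R, L]%classic)).
    by apply: le_mu => //; [exact: measurable_sec|exact: sec_bounded].
  rewrite lebesgue_measure_itv/= lte_fin; case: ltP => h; last by rewrite lee_fin; lra.
  by rewrite -EFinB lee_fin; lra.
have mA1 := measurable_lam_sec w mAD; have mA2 := measurable_lam_sec w mDA.
rewrite mulrC EFinM; apply: (@le_trans _ _ ((2 * L)^-1%:E * section_overlap (A `\` D) (D `\` A) w)).
  by apply: lee_wpmul2l => //; rewrite lee_fin ltW.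
rewrite /section_overlap -ge0_integralZl; [|exact: measurableT|exact: emeasurable_funM|by move=> u _; rewrite mule_ge0|by rewrite lee_fin ltW].
apply: integral_leT => u; first by rewrite !mule_ge0// lee_fin ltW.
have := secle _ mAD ADL u; have := secle _ mDA DAL u.
have : 0 <= lam (sec w (A `\` D) u) by exact: measure_ge0.
have : 0 <= lam (sec w (D `\` A) u) by exact: measure_ge0.
move: (lam (sec w (A `\` D) u)) (lam (sec w (D `\` A) u)) => [x| |] [y| |]//.
rewrite !lee_fin => y0 x0 yL xL; rewrite -!EFinM -EFin_min lee_fin mulrC ler_pdivrMr ?mulr_gt0//.
by case: (leP x y) => xy; [|rewrite mulrC]; apply: ler_wpM2l.
Qed.

(** This and the analogues for B and C bound the loss in passing to the balls. Only the one-sided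
    differences enter, so driving the excesses to 0 is enough. *)
Lemma tri_leA A A' B C : measurable A -> measurable A' -> measurable B -> measurable C ->
  tri A B C <= tri A' B C + mu (A `\` A') * mu B.
Proof.
move=> mA mA' mB mC; have mD : measurable (A `\` A') by exact: measurableD.
rewrite -product_measure1E// /tri.
have mX : measurable ((A `\` A') `*` B : set (W * W)) by exact: measurableX.
have mT := measurable_trisetV mA' mB mC.
apply: le_trans (measureU2 (mu \x mu) mT mX).
apply: (@le_mu _ _ _ (mu \x mu)).
- exact: measurable_trisetV.
- exact: measurableU.
move=> [x y] [/= Ax By Cxy]; have [A'x|A'x] := pselect (A' x); [left|right]; split => //.
Qed.

Lemma tri_leB A B B' C : measurable A -> measurable B' -> measurable B -> measurable C ->
  tri A B C <= tri A B' C + mu A * mu (B `\` B').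
Proof.
move=> mA mB' mB mC; have mD : measurable (B `\` B') by exact: measurableD.
rewrite -product_measure1E// /tri.
have mX : measurable (A `*` (B `\` B') : set (W * W)) by exact: measurableX.
have mT := measurable_trisetV mA mB' mC.
apply: le_trans (measureU2 (mu \x mu) mT mX).
apply: (@le_mu _ _ _ (mu \x mu)).
- exact: measurable_trisetV.
- exact: measurableU.
move=> [x y] [/= Ax By Cxy]; have [A'x|A'x] := pselect (B' y); [left|right]; split => //.
Qed.

Lemma triTE A C : measurable A -> measurable C -> tri A setT C = mu A * mu C.
Proof.
move=> mA mC; rewrite /tri product_measureE; last exact: measurable_trisetV.
rewrite [X in X * _]integralTE// -ge0_integralZr; [|exact: measurableT|exact: measurable_indicE|by move=> x _; rewrite lee_fin|exact: measure_ge0].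
apply: eq_integral => x _; rewrite [mu C]integralTE//.
have mI : measurable_fun setT (fun x : W => (\1_C x : R)%:E) by exact: measurable_indicE.
rewrite -(@ge0_integral_muV_shift R _ x (fun y => (\1_C y)%:E)); [|exact: mI|by move=> y; rewrite lee_fin].
rewrite -ge0_integralZl; [|exact: measurableT| |by move=> y _; rewrite lee_fin|by rewrite lee_fin]; last first.
  by apply: (measurableT_comp mI); exact: measurable_addV.
apply: eq_integral => y _; rewrite -EFinM; congr EFin.
have [Ax|Ax] := pselect (A x); last first.
  by rewrite [in RHS]indicE (memNset Ax) mul0r indicE memNset// => -[].
rewrite [X in (X * _)%R]indicE (mem_set Ax) mul1r !indicE; congr ((_ : bool)%:R)%R.
apply/idP/idP; rewrite !inE; first by case=> /= _ _; rewrite addrC.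
by move=> Cyx; split => //=; rewrite addrC.
Qed.

Lemma tri_leC A B C C' : measurable A -> measurable B -> measurable C -> measurable C' ->
  tri A B C <= tri A B C' + mu A * mu (C `\` C').
Proof.
move=> mA mB mC mC'; have mD : measurable (C `\` C') by exact: measurableD.
rewrite -triTE// /tri.
have mX := measurable_trisetV mA (@measurableT _ W) mD.
have mT := measurable_trisetV mA mB mC'.
apply: le_trans (measureU2 (mu \x mu) mT mX).
apply: (@le_mu _ _ _ (mu \x mu)).
- exact: measurable_trisetV.
- exact: measurableU.
move=> [x y] [/= Ax By Cxy]; have [A'x|A'x] := pselect (C' (x + y)%R); [left|right]; split => //.
Qed.

End riesz.

(** * Minimizing the excess, and Riesz' inequality *)

Section riesz_balls.
Local Open Scope ereal_scope.
Variables (R : realType) (m : nat).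
Local Notation W := (borel_rV R m.+1).
Local Notation mu := (muV R m.+1).
Implicit Types (A B C D K : set W).

(** The bounding set has to be a Euclidean ball: it must be [centered] in order to be kept by
    [steiner_sub], which a cube in general is not. *)
Definition cball (L : R) : set W := [set x | (enorm (x : 'rV[R]_m.+1) <= L)%R].

Lemma cball_ball0 L : (0 <= L)%R -> ball0 (cball L).
Proof. by move=> L0; exists L => //; right. Qed.

Lemma cball_coords L : (0 <= L)%R -> cball L `<=` coords_le L.
Proof. by move=> L0 x; rewrite /cball/= enorm_le// => h i; exact: sumsq_coord. Qed.

Definition excess A D : R := fine (mu (A `\` D)).

Lemma excessE L A D : (0 < L)%R -> measurable A -> measurable D -> A `<=` cball L ->
  mu (A `\` D) = (excess A D)%:E.
Proof.
move=> L0 mA mD AL; rewrite /excess fineK//; apply: (bounded_fin L0).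
  exact: measurableD.
by move=> x [/AL/(cball_coords (ltW L0))].
Qed.

Section bounded.
Variables (L : R) (A' B' C' : set W).
Hypotheses (L0 : (0 < L)%R) (bA' : ball0 A') (bB' : ball0 B') (bC' : ball0 C')
  (A'L : A' `<=` coords_le L) (B'L : B' `<=` coords_le L) (C'L : C' `<=` coords_le L).

(** Preserved by every symmetrization. The measures are compared by an inequality because truncation
    to a ball, in [riesz], may lower them. *)
Let admissible A D := [/\ measurable A, A `<=` cball L & mu A <= mu D].

Let steiner_admissible w A D : admissible A D -> admissible (steiner w A) D.
Proof.
have cK := cball_ball0 (ltW L0).
move=> [mA AK AD]; split; first exact: measurable_steiner.
  by apply: steiner_sub => //; [exact: ball0_measurable|exact: ball0_centered].
rewrite (@muV_steiner _ _ _ _ L)//.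
exact: subset_trans (cball_coords (ltW L0)).
Qed.

Let excess_steiner w A D : ball0 D -> admissible A D ->
  (excess (steiner w A) D <= excess A D)%R.
Proof.
move=> bD aA; have [mS SK _] := steiner_admissible w aA; have [mA AK AD] := aA.
have mD := ball0_measurable bD.
rewrite -lee_fin -!(@excessE L)//.
apply: le_trans (steiner_decrease w mA mD (ball0_centered bD) _).
  by rewrite leeDl//; apply: integral_ge0 => u _; rewrite le_min !measure_ge0.
exact: subset_trans (cball_coords (ltW L0)).
Qed.

Let excess_gain (eta : R) : (0 < eta)%R -> exists2 kappa : R, (0 < kappa)%R &
  forall A D, ball0 D -> D `<=` coords_le L -> admissible A D -> (eta <= excess A D)%R ->
  exists w : 'rV[R]_m, (excess (steiner w A) D + kappa <= excess A D)%R.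
Proof.
move=> eta0; have [kap kap0 H] := @steiner_gain R m _ _ L0 eta0.
exists kap => // A D bD DL aA; have [mA AK AD] := aA.
have mD := ball0_measurable bD.
rewrite -lee_fin -(@excessE L)// => eAD.
have AL : A `<=` coords_le L by exact: subset_trans (cball_coords (ltW L0)).
have [w Hw] := H A D mA mD (ball0_centered bD) AL DL AD eAD.
exists w; rewrite -lee_fin EFinD -!(@excessE L)//.
  exact: measurable_steiner.
by have [] := steiner_admissible w aA.
Qed.

(** Total excesses of admissible triples whose functional is at least that of A, B, C. It keeps just
    what a symmetrization preserves, so iterates need not be recorded. *)
Let reachable (A B C : set W) (r : R) := exists A1 B1 C1,
  [/\ admissible A1 A', admissible B1 B', admissible C1 C',
   tri A B C <= tri A1 B1 C1 &
   r = (excess A1 A' + excess B1 B' + excess C1 C')%R].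

Let excess_ge0 A D : (0 <= excess A D)%R. Proof. exact: fine_ge0. Qed.

(** Were e a lower bound, a triple within kappa of the infimum would have some excess at least e /
    3. Symmetrizing all three sets in the direction good for that one lowers its excess by kappa and
    raises no other, which falls below the infimum. *)
Let reach_small A B C (e : R) :
  admissible A A' -> admissible B B' -> admissible C C' -> (0 < e)%R ->
  exists2 r, reachable A B C r & (r < e)%R.
Proof.
move=> aA aB aC e0; apply: contrapT => hN.
have lbS : lbound (reachable A B C) e.
  by move=> r Sr; rewrite leNgt; apply/negP => re; apply: hN; exists r.
have hS : has_inf (reachable A B C).
  split; last by exists e.
  by exists (excess A A' + excess B B' + excess C C')%R; exists A, B, C.
have e30 : (0 < e / 3)%R by rewrite divr_gt0.
have [kap kap0 H] := excess_gain e30.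
have [r Sr rlt] := inf_adherent kap0 hS.
have er := lbS _ Sr.
have [A1 [B1 [C1 [aA1 aB1 aC1 tle rE]]]] := Sr.
suff [w Hw] : exists w, (excess (steiner w A1) A' + excess (steiner w B1) B' + excess (steiner w C1) C' + kap <= r)%R.
  have : reachable A B C (excess (steiner w A1) A' + excess (steiner w B1) B' + excess (steiner w C1) C')%R.
    exists (steiner w A1), (steiner w B1), (steiner w C1).
    split; [exact: steiner_admissible|exact: steiner_admissible|exact: steiner_admissible| |by []].
    apply: (le_trans tle).
    have [mA1 KA1 _] := aA1; have [mB1 KB1 _] := aB1; have [mC1 KC1 _] := aC1.
    have sub A0 (AK0 : A0 `<=` cball L) := subset_trans AK0 (cball_coords (ltW L0)).
    by apply: (@tri_steiner _ _ w _ _ _ L); [| | |exact: sub|exact: sub|exact: sub].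
  by move=> /(ge_inf hS.2) h; lra.
have [hA|hA] := leP (e / 3)%R (excess A1 A').
  have [w hw] := H _ _ bA' A'L aA1 hA; exists w.
  by have := excess_steiner w bB' aB1; have := excess_steiner w bC' aC1; lra.
have [hB|hB] := leP (e / 3)%R (excess B1 B').
  have [w hw] := H _ _ bB' B'L aB1 hB; exists w.
  by have := excess_steiner w bA' aA1; have := excess_steiner w bC' aC1; lra.
have hC : (e / 3 <= excess C1 C')%R by lra.
have [w hw] := H _ _ bC' C'L aC1 hC; exists w.
by have := excess_steiner w bA' aA1; have := excess_steiner w bB' aB1; lra.
Qed.

Lemma riesz_bounded A B C :
  measurable A -> measurable B -> measurable C ->
  A `<=` cball L -> B `<=` cball L -> C `<=` cball L ->
  mu A <= mu A' -> mu B <= mu B' -> mu C <= mu C' ->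
  tri A B C <= tri A' B' C'.
Proof.
move=> mA mB mC AK BK CK AA' BB' CC'.
have mA' := ball0_measurable bA'; have mB' := ball0_measurable bB'; have mC' := ball0_measurable bC'.
have fA' := bounded_fin L0 mA' A'L; have fB' := bounded_fin L0 mB' B'L.
set a := fine (mu A'); set b := fine (mu B').
have aE : mu A' = a%:E by rewrite /a fineK.
have bE : mu B' = b%:E by rewrite /b fineK.
have a0 : (0 <= a)%R by rewrite fine_ge0.
have b0 : (0 <= b)%R by rewrite fine_ge0.
apply/lee_addgt0Pr => e e0.
(* The loss is at most a + b times the total excess, so e / (a + b + 1) is small enough; the 1 keeps
   the divisor positive when both balls are null. *)
have M0 : (0 < a + b + 1)%R by lra.
have [||||r [A1 [B1 [C1 [[mA1 AK1 AA1] [mB1 BK1 BB1] [mC1 CK1 CC1] tle ->]]]] rlt] :=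
  @reach_small A B C (e / (a + b + 1))%R; try by [].
  by rewrite divr_gt0.
apply: (le_trans tle); apply: (le_trans (tri_leA mA1 mA' mB1 mC1)).
apply: (@le_trans _ _ (tri A' B' C' + (mu A' * mu (C1 `\` C')) + mu A' * mu (B1 `\` B') + mu (A1 `\` A') * mu B1)).
  apply: leeD2r; apply: (le_trans (tri_leB mA' mB' mB1 mC1)); apply: leeD2r.
  exact: tri_leC.
move: (tri A' B' C') => T; rewrite -!addeA; apply: leeD2l.
rewrite !(@excessE L)// aE; apply: (@le_trans _ _ ((a * excess C1 C')%R%:E + ((a * excess B1 B')%R%:E + (excess A1 A' * b)%R%:E))).
  rewrite !EFinM. do 2 apply: leeD2l; apply: lee_wpmul2l; first by rewrite lee_fin.
  by rewrite -bE.
rewrite -!EFinD lee_fin; move: rlt; rewrite ltr_pdivlMr//.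
have := excess_ge0 A1 A'; have := excess_ge0 B1 B'; have := excess_ge0 C1 C'.
move: (excess A1 A') (excess B1 B') (excess C1 C') => x y z z0 y0 x0 h.
have h1 : (0 <= x * a)%R by rewrite mulr_ge0.
have h2 : (0 <= y * b)%R by rewrite mulr_ge0.
have h3 : (0 <= z * b)%R by rewrite mulr_ge0.
by lra.
Qed.

End bounded.

(** Truncation to balls of radius n reduces to the bounded case, and the functional passes to the
    limit by continuity from below. *)
Lemma riesz A B C A' B' C' :
  measurable A -> measurable B -> measurable C ->
  ball0 A' -> ball0 B' -> ball0 C' ->
  mu A <= mu A' -> mu B <= mu B' -> mu C <= mu C' ->
  tri A B C <= tri A' B' C'.
Proof.
move=> mA mB mC bA' bB' bC' AA' BB' CC'.
have [La La0 A'L] := ball0_coords bA'; have [Lb Lb0 B'L] := ball0_coords bB'.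
have [Lc Lc0 C'L] := ball0_coords bC'.
have mK n : measurable (cball n%:R) by apply: ball0_measurable; exact: cball_ball0.
pose F n : set (W * W) := triset (A `&` cball n%:R : set 'rV[R]_m.+1) (B `&` cball n%:R) (C `&` cball n%:R).
have mF n : measurable (F n) by apply: measurable_trisetV; exact: measurableI.
have FE : \bigcup_n F n = triset (A : set 'rV[R]_m.+1) B C.
  apply/seteqP; split => [p [n _ [[? _] [? _] [? _]]]//|p [Ap Bp Cp]].
  pose M := (enorm (p.1 : 'rV[R]_m.+1) + enorm (p.2 : 'rV[R]_m.+1) + enorm ((p.1 : 'rV[R]_m.+1) + p.2))%R.
  have s0 (x : 'rV[R]_m.+1) : (0 <= enorm x)%R by exact: sqrtr_ge0.
  have M0 : (0 <= M)%R by rewrite !addr_ge0.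
  exists (Num.bound M) => //; have hM := archi_boundP M0.
  have := s0 p.1; have := s0 p.2; have := s0 ((p.1 : 'rV[R]_m.+1) + p.2)%R => h1 h2 h3.
  by split; split => //; rewrite /cball/=; apply: le_trans (ltW hM); rewrite /M; lra.
have ndF : nondecreasing_seq F.
  move=> n k nk; apply/subsetPset => p [[? h1] [? h2] [? h3]].
  have nkR : (n%:R <= k%:R :> R)%R by rewrite ler_nat.
  by split; split => //; rewrite /cball/=; [exact: le_trans h1 nkR|exact: le_trans h2 nkR|exact: le_trans h3 nkR].
have mU : measurable (\bigcup_n F n) by exact: bigcupT_measurable.
have cF := @nondecreasing_cvg_mu _ _ _ (mu \x mu) F mF mU ndF.
rewrite /tri -FE -(cvg_lim _ cF)//.
apply: lime_le; first by apply/cvg_ex; eexists; exact: cF.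
apply: nearW => n.
(* Large enough for the truncated sets and for the three balls at once. *)
pose L : R := (n%:R + La + Lb + Lc + 1)%R.
have n0 : (0 <= n%:R :> R)%R by exact: ler0n.
have L0 : (0 < L)%R by rewrite /L; lra.
have cl (D : set W) (l : R) : D `<=` coords_le l -> (l <= L)%R -> D `<=` coords_le L.
  by move=> Dl lL x /Dl h i; exact: le_trans (h i) lL.
have kl (D : set W) : D `&` cball n%:R `<=` cball L.
  by move=> x [_]; rewrite /cball/= => h; apply: (le_trans h); rewrite /L; lra.
apply: (@riesz_bounded L A' B' C') => //.
- by apply: cl A'L _; rewrite /L; lra.
- by apply: cl B'L _; rewrite /L; lra.
- by apply: cl C'L _; rewrite /L; lra.
- exact: measurableI.
- exact: measurableI.
- exact: measurableI.
- by apply: le_trans AA'; apply: le_mu => //; exact: measurableI.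
- by apply: le_trans BB'; apply: le_mu => //; exact: measurableI.
- by apply: le_trans CC'; apply: le_mu => //; exact: measurableI.
Qed.

End riesz_balls.

(** * Lebesgue outer measure *)

Section leb_outer.
Local Open Scope ereal_scope.
Variables (R : realType) (m : nat).
Local Notation W := (borel_rV R m.+1).
Local Notation mu := (muV R m.+1).
Local Notation rV := 'rV[R]_m.+1.

Definition vol (p : rV * rV) : \bar R := (\prod_i (p.2 0 i - p.1 0 i))%R%:E.

Lemma vol_ge0 (p : rV * rV) : (forall i, p.1 0 i <= p.2 0 i)%R -> 0 <= vol p.
Proof. by move=> h; rewrite lee_fin prodr_ge0// => i _; rewrite subr_ge0. Qed.

(** Positive dimension matters: in dimension 0 each box has volume the empty product 1, every
    countable cover has infinite total, and the empty set would not be null. *)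
Definition lebS : set rV -> \bar R := @leb R m.+1.

Lemma lebS_le_cover (X : set rV) c : box_cover X c -> lebS X <= \sum_(k <oo) vol (c k).
Proof. by move=> cX; apply: ereal_inf_lbound; exists c. Qed.

Lemma lebS_ge0 X : 0 <= lebS X.
Proof.
apply: le_ereal_inf_tmp => _ [c [cle _] <-]; apply: nneseries_ge0 => k _ _.
exact: vol_ge0.
Qed.

Lemma le_lebS : {homo lebS : A B / A `<=` B >-> A <= B}.
Proof.
move=> A B AB; apply/ereal_inf_le_tmp => _ [c [c1 c2] <-]; exists c => //; split => //.
exact: subset_trans c2.
Qed.

Lemma lebS0 : lebS set0 = 0.
Proof.
apply/eqP; rewrite eq_le lebS_ge0 andbT.
apply: (@le_trans _ _ (\sum_(k <oo) vol ((fun=> (0%R, 0%R)) k))).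
  by apply: lebS_le_cover; split.
by rewrite eseries0// => k _ _; rewrite /vol big_ord_recl/= subrr mul0r.
Qed.

(** The enumeration is fixed before the series, since the same one must also list the boxes of the
    merged cover. *)
Lemma double_series : exists2 f : nat -> nat * nat, (forall p, exists j, f j = p) &
  forall a : nat -> nat -> \bar R, (forall n k, 0 <= a n k) ->
  \sum_(n <oo) \sum_(k <oo) a n k = \sum_(j <oo) a (f j).1 (f j).2.
Proof.
have /card_set_bijP[f [_ finj fsurj]] : ([set: nat] #= [set: nat * nat])%card.
  by rewrite card_eq_sym; exact: card_nat2.
exists f => [p|a a0].
  by have [j _ <-] := fsurj p Logic.I; exists j.
rewrite (@nneseries_esumT R (fun n => \sum_(k <oo) a n k)); last by move=> n; apply: nneseries_ge0 => k _ _.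
under eq_esum do rewrite nneseries_esumT//.
rewrite esum_esum// nneseries_esumT//.
rewrite (_ : _ `*`` _ = [set: nat * nat]); last by apply/seteqP; split.
exact: (@reindex_esum _ _ _ setT setT f (fun p => a p.1 p.2)).
Qed.

Lemma lebS_sigma_subadditive : sigma_subadditive lebS.
Proof.
move=> A; have [[i ioo]|] := pselect (exists i, lebS (A i) = +oo).
  rewrite (eseries_pinfty _ _ ioo) ?leey// => n _.
  by rewrite -ltNye (lt_le_trans _ (lebS_ge0 _)).
move=> /forallNP Aoo.
have Afin n : lebS (A n) \is a fin_num.
  by rewrite ge0_fin_numE ?lebS_ge0// ltey; apply/eqP; exact: Aoo.
apply/lee_addgt0Pr => e e0.
apply: le_trans (epsilon_trick _ (fun n => lebS_ge0 (A n)) (ltW e0)).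
have H n : exists c, box_cover (A n) c /\
    \sum_(k <oo) vol (c k) <= lebS (A n) + (e / (2 ^ n.+1)%:R)%R%:E.
  have en : (0 < e / (2 ^ n.+1)%:R)%R by rewrite divr_gt0// ltr0n expn_gt0.
  have [_ [c cX <-] h] := lb_ereal_inf_adherent en (Afin n).
  by exists c; split => //; exact: ltW.
have [c cP] := choice H.
have [f fsurj fE] := double_series.
have v0 n k : 0 <= vol (c n k) by apply: vol_ge0; have [[+ _] _] := cP n; exact.
apply: (@le_trans _ _ (\sum_(j <oo) vol (c (f j).1 (f j).2))).
  apply: (@lebS_le_cover _ (fun j => c (f j).1 (f j).2)); split.
    by move=> j i; have [[+ _] _] := cP (f j).1; exact.
  move=> x [n _ Anx]; have [[_ cov] _] := cP n.
  have [k _ bx] := cov _ Anx; have [j fj] := fsurj (n, k).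
  by exists j => //=; rewrite fj.
rewrite -(fE (fun n k => vol (c n k)) v0); apply: lee_nneseries => [n _ _|n _]; first by apply: nneseries_ge0 => k _ _.
by have [] := cP n.
Qed.

HB.instance Definition _ := isOuterMeasure.Build R rV lebS lebS0 lebS_ge0 le_lebS
  lebS_sigma_subadditive.

Let clamp (a b c : R) : R := Num.min (Num.max a c) b.

(** Cut each box of a cover of X along the hyperplane. Clamping the cut to the box keeps both pieces
    ordered, one being flat if the hyperplane misses the box; volumes add up and the pieces cover
    the two parts of X. *)
Lemma half_space_caratheodory i (c : R) :
  lebS.-caratheodory [set x : rV | (c < x 0 i)%R].
Proof.
apply: le_caratheodory_measurable => X; apply: le_ereal_inf_tmp => _ [k [kle kcov] <-].
pose t n := clamp ((k n).1 0%R i) ((k n).2 0%R i) c.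
pose up n : rV * rV := ((\row_j (if j == i then t n else (k n).1 0 j))%R, (k n).2).
pose dn n : rV * rV := ((k n).1, (\row_j (if j == i then t n else (k n).2 0 j))%R).
have tle n : ((k n).1 0%R i <= t n <= (k n).2 0%R i)%R.
  by rewrite /t /clamp ge_min lexx orbT andbT le_min kle le_max lexx.
have uple n j : ((up n).1 0 j <= (up n).2 0 j)%R.
  by rewrite /= mxE; case: eqP => [->|_]; [have /andP[] := tle n|exact: kle].
have dnle n j : ((dn n).1 0 j <= (dn n).2 0 j)%R.
  by rewrite /= mxE; case: eqP => [->|_]; [have /andP[] := tle n|exact: kle].
have volE n : vol (k n) = vol (up n) + vol (dn n).
  rewrite /vol -EFinD; congr EFin.
  have bD (F : 'I_m.+1 -> R) : (\prod_j F j = F i * \prod_(j | j != i) F j)%R.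
    by rewrite (bigD1 i).
  rewrite (bD (fun j => (k n).2 0 j - (k n).1 0 j)%R) (bD (fun j => (up n).2 0 j - (up n).1 0 j)%R)
    (bD (fun j => (dn n).2 0 j - (dn n).1 0 j)%R).
  rewrite [X in (_ = _ * X + _)%R](eq_bigr (fun j => (k n).2 0 j - (k n).1 0 j)%R); last first.
    by move=> j /negbTE ji; rewrite mxE ji.
  rewrite [X in (_ = _ + _ * X)%R](eq_bigr (fun j => (k n).2 0 j - (k n).1 0 j)%R); last first.
    by move=> j /negbTE ji; rewrite mxE ji.
  by rewrite /= !mxE eqxx; ring.
suff : lebS (X `&` [set x : rV | (c < x 0 i)%R]) + lebS (X `&` ~` [set x : rV | (c < x 0 i)%R]) <=
  \sum_(n <oo) vol (k n) by [].
rewrite (eq_eseriesr (fun n _ => volE n)).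
rewrite nneseriesD; [|by move=> n _ _; exact: vol_ge0|by move=> n _ _; exact: vol_ge0].
apply: leeD; apply: lebS_le_cover; split => //.
  move=> x [Xx /= cx]; have [n _ kx] := kcov _ Xx; exists n => // j.
  rewrite /= mxE; have := kx j; case: eqP => [->|//] /andP[h1 h2].
  by rewrite h2 andbT /t /clamp gt_min gt_max h1 cx.
move=> x [Xx /= /negP]; rewrite -leNgt => cx; have [n _ kx] := kcov _ Xx; exists n => // j.
rewrite /= mxE; have := kx j; case: eqP => [->|//] /andP[h1 h2].
by rewrite h1/= /t /clamp le_min h2 andbT le_max cx orbT.
Qed.

Let lebO : {outer_measure set rV -> \bar R} := lebS.
Let CT := caratheodory_type lebO.

(** Borel sets are thus Caratheodory measurable. Pushed forward along this identity, the outer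
    measure becomes a Borel measure, to which [muV_unique] applies in [lebS_borel]. *)
Let measurable_id_caratheodory : measurable_fun setT (id : CT -> W).
Proof.
apply: measurable_rV => i; apply: (measurability _ (RGenOInfty.measurableE R)).
move=> _ [_ [c ->] <-]; rewrite setTI.
rewrite (_ : _ @^-1` _ = [set x : rV | (c < x 0 i)%R]); last first.
  by apply/seteqP; split => x /=; rewrite in_itv/= andbT.
exact: half_space_caratheodory.
Qed.

Lemma muV_le_cover (A : set W) c : measurable A -> box_cover A c ->
  mu A <= \sum_(k <oo) vol (c k).
Proof.
move=> mA [cle cov].
rewrite (eq_eseriesr (fun k _ => _ : _ = mu (box (c k).1 (c k).2))); last first.
  by move=> k _; rewrite muV_box.
by apply: measure_sigma_subadditive => // k; exact: measurable_box.
Qed.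

(** The lower bound, classically a compactness argument, comes from comparison with [muV], which is
    already known to be countably subadditive. *)
Lemma lebS_box (a b : rV) : (forall i, a 0 i <= b 0 i)%R -> lebS (box a b) = vol (a, b).
Proof.
move=> ab; apply/eqP; rewrite eq_le; apply/andP; split.
  pose c (k : nat) : rV * rV := if k == 0%N then (a, b) else (0%R, 0%R).
  apply: (@le_trans _ _ (\sum_(k <oo) vol (c k))).
    apply: lebS_le_cover; split; first by move=> [|k] i.
    by move=> x h; exists 0%N.
  rewrite nneseries_recl//; last first.
    by move=> [|k] _; apply: vol_ge0.
  rewrite eseries0 ?adde0// => -[//|k] _ _.
  by rewrite /vol big_ord_recl/= subrr mul0r.
apply: le_ereal_inf_tmp => _ [c cX <-].
rewrite (_ : vol (a, b) = mu (box a b)); last by rewrite muV_box.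
exact: (muV_le_cover (measurable_box a b) cX).
Qed.

Lemma lebS_borel (A : set W) : measurable A -> lebS A = mu A.
Proof.
pose pf : {measure set W -> \bar R} :=
  measure_function_pushforward__canonical__measure_function_Measure
  (OuterMeasure_sort__canonical__measure_function_Measure lebO) measurable_id_caratheodory.
move=> mA; apply: (@muV_unique _ _ pf) => // a b ab.
exact: lebS_box.
Qed.

Lemma borel_hull (X : set rV) : lebS X < +oo -> exists G : set W,
  [/\ measurable G, X `<=` G & mu G = lebS X].
Proof.
move=> Xoo; have Xfin : lebS X \is a fin_num by rewrite ge0_fin_numE ?lebS_ge0.
have H (n : nat) : exists c, box_cover X c /\ \sum_(k <oo) vol (c k) <= lebS X + n.+1%:R^-1%:E.
  have n0 : (0 < n.+1%:R^-1 :> R)%R by rewrite invr_gt0.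
  have [_ [c cX <-] h] := lb_ereal_inf_adherent n0 Xfin.
  by exists c; split => //; exact: ltW.
have [c cP] := choice H.
pose F n : set W := \bigcup_k box (c n k).1 (c n k).2.
have mF n : measurable (F n) by apply: bigcupT_measurable => k; exact: measurable_box.
have mG : measurable (\bigcap_n F n) by exact: bigcapT_measurable.
exists (\bigcap_n F n); split => //.
  by move=> x Xx n _; have [[_ cov] _] := cP n; exact: cov.
apply/eqP; rewrite eq_le; apply/andP; split; last first.
  rewrite -lebS_borel//; apply: le_lebS => x Xx n _.
  by have [[_ cov] _] := cP n; exact: cov.
apply/lee_addgt0Pr => e e0.
have [n ne] : exists n : nat, (n.+1%:R^-1 < e)%R.
  exists (Num.bound e^-1); rewrite invf_plt ?posrE//.
  have e1 : (0 <= e^-1)%R by rewrite invr_ge0 ltW.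
  by apply: (lt_le_trans (archi_boundP e1)); rewrite ler_nat.
apply: (@le_trans _ _ (mu (F n))); first by apply: le_mu; [exact: mG|exact: mF|move=> x; exact].
have [[c1 c2] c3] := cP n.
apply: (@le_trans _ _ (\sum_(k <oo) vol (c n k))); first by apply: muV_le_cover; [exact: mF|split].
by apply: (le_trans c3); apply: leeD2l; rewrite lee_fin ltW.
Qed.

(** Take a Borel hull G of A. The Caratheodory property tested on G makes G \ A null, so it has a
    null Borel hull N, and G \ N lies inside A. *)
Lemma borel_kernel (A : set rV) : lebS.-caratheodory A -> lebS A < +oo ->
  exists A0 : set W, [/\ measurable A0, A0 `<=` A, lebS (A `\` A0) = 0 & mu A0 = lebS A].
Proof.
move=> cA Aoo; have [G [mG AG GE]] := borel_hull Aoo.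
have GA0 : lebS (G `\` A) = 0.
  have := cA G; rewrite lebS_borel// GE (_ : G `&` A = A); last first.
    by apply/seteqP; split => [x []//|x Ax]; split => //; exact: AG.
  have Af : lebS A \is a fin_num by rewrite ge0_fin_numE ?lebS_ge0.
  by rewrite -setDE => /eqP; rewrite addeC -sube_eq ?subee// ?fin_num_adde_defl// => /eqP.
have [N [mN GN NE]] : exists G0 : set W, [/\ measurable G0, G `\` A `<=` G0 & mu G0 = lebS (G `\` A)].
  by apply: borel_hull; rewrite GA0.
rewrite GA0 in NE.
have mGN : measurable (G `\` N) by exact: measurableD.
exists (G `\` N); split => //.
- by move=> x [Gx Nx]; apply: contrapT => Ax; apply: Nx; apply: GN.
- apply/eqP; rewrite eq_le lebS_ge0 andbT -NE -lebS_borel//; apply: le_lebS => x [Ax].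
  by move=> h; apply: contrapT => Nx; apply: h; split => //; exact: AG.
- have : mu (G `&` N) = 0 by apply: subset_measure0 NE => //; exact: measurableI.
  move=> GN0; have h : mu G = mu (G `\` N) + mu (G `&` N) by exact: measureDI.
  by rewrite -GE h GN0 adde0.
Qed.

End leb_outer.

(** * Random translates *)

Section convolution.
Local Open Scope ereal_scope.
Variables (R : realType) (m : nat).
Local Notation W := (borel_rV R m.+1).
Local Notation mu := (muV R m.+1).
Local Notation rV := 'rV[R]_m.+1.
Implicit Types A B C : set W.

(* |B \cap (z - A)|, i.e. the convolution of the indicators of A and B. *)
Definition conv A B (z : W) : \bar R := mu [set y : W | B y /\ A ((z : rV) - y)%R].

Let cset A B : set (W * W) := [set p | B p.2 /\ A ((p.1 : rV) - p.2)%R].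

Let measurable_cset A B : measurable A -> measurable B -> measurable (cset A B).
Proof.
move=> mA mB.
rewrite (_ : cset A B = snd @^-1` B `&` (fun p : W * W => ((p.1 : rV) - p.2)%R : W) @^-1` A)//.
apply: measurableI; first exact: measurable_preT.
by apply: measurable_preT => //; exact: measurable_subV.
Qed.

Lemma measurable_conv_set A B (z : W) : measurable A -> measurable B ->
  measurable [set y : W | B y /\ A ((z : rV) - y)%R].
Proof.
move=> mA mB.
have := measurable_xsection z (measurable_cset mA mB); congr measurable.
by apply/seteqP; split => y; rewrite /xsection/= inE.
Qed.

Let convI A B z : measurable A -> measurable B ->
  conv A B z = \int[mu]_y (\1_(cset A B) (z, y))%:E.
Proof.
move=> mA mB; rewrite /conv integralTE.
  by apply: eq_integral => y _; rewrite !indicE; congr ((_ : bool)%:R)%:E; apply/idP/idP; rewrite !inE.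
exact: measurable_conv_set.
Qed.

Lemma measurable_conv A B : measurable A -> measurable B -> measurable_fun setT (conv A B).
Proof.
move=> mA mB; rewrite (funext (fun z => convI z mA mB)).
apply: (@measurable_integral2 _ _ W W R mu (fun z y => (\1_(cset A B) (z, y))%:E)) => //.
rewrite (_ : (fun p => _) = (fun p : W * W => (\1_(cset A B) p : R)%:E)).
  exact: measurable_indicE (measurable_cset mA mB).
by apply/funext => -[].
Qed.

Lemma conv_ge0 A B z : 0 <= conv A B z. Proof. exact: measure_ge0. Qed.

Lemma conv_le A B z : measurable A -> measurable B -> conv A B z <= mu B.
Proof.
move=> mA mB; apply: le_mu => //; last by move=> y [].
exact: measurable_conv_set.
Qed.

Lemma tri_conv A B C : measurable A -> measurable B -> measurable C ->
  tri A B C = \int[mu]_z ((\1_C z)%:E * conv A B z).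
Proof.
move=> mA mB mC; pose T : set (W * W) := triset (A : set rV) B C.
have mT : measurable T by exact: measurable_trisetV.
have mI : measurable_fun setT (fun p : W * W => (\1_T p : R)%:E) by exact: measurable_indicE.
rewrite /tri product_measureE//.
rewrite (@integral_swap _ _ W W R mu mu (fun x y => (\1_T (x, y))%:E)); last 2 first.
- by rewrite (_ : (fun p => _) = (fun p => (\1_T p)%:E))//; apply/funext => -[].
- by move=> x y; rewrite lee_fin.
transitivity (\int[mu]_y \int[mu]_z (\1_T (((z : rV) - y)%R, y) : R)%:E).
  apply: eq_integral => y _.
  rewrite -(@ge0_integral_muV_shift _ _ (- (y : rV))%R (fun x => (\1_T (x, y))%:E))//.
  by apply: (measurableT_comp mI); exact: measurable_fun_pair.
rewrite (@integral_swap _ _ W W R mu mu (fun y z => (\1_T (((z : rV) - y)%R, y))%:E)); last 2 first.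
- apply: (measurableT_comp mI); apply: measurable_fun_pair => //.
  exact: measurable_subV.
- by move=> x y; rewrite lee_fin.
apply: eq_integral => z _; rewrite convI//.
have mc := measurable_cset mA mB.
rewrite -ge0_integralZl; [|exact: measurableT| |by move=> y _; rewrite lee_fin|by rewrite lee_fin]; last first.
  have mI2 : measurable_fun setT (fun p : W * W => (\1_(cset A B) p : R)%:E) by exact: measurable_indicE.
  by apply: (measurableT_comp mI2); exact: measurable_fun_pair.
apply: eq_integral => y _; rewrite -EFinM; congr EFin.
have [Cz|Cz] := pselect (C z); last first.
  by rewrite [in RHS]indicE (memNset Cz) mul0r indicE memNset// => -[/= _ _]; rewrite subrK.
rewrite [X in (X * _)%R]indicE (mem_set Cz) mul1r !indicE; congr ((_ : bool)%:R)%R.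
apply/idP/idP; rewrite !inE; first by case=> /= ? ? _; split.
by move=> [/= By Azy]; split => //=; rewrite subrK.
Qed.

Lemma integral_conv A B : measurable A -> measurable B ->
  \int[mu]_z conv A B z = mu A * mu B.
Proof.
move=> mA mB; rewrite -(product_measure1E mu mu mA mB).
transitivity (tri A B setT).
  rewrite (tri_conv mA mB (@measurableT _ W)); apply: eq_integral => z _.
  by rewrite indicE mem_set// mul1e.
by rewrite /tri; congr ((_ \x _) _); apply/seteqP; split => p; [case|case].
Qed.

Lemma muV_shift (d : rV) (D : set W) : measurable D ->
  mu [set x : W | D ((x : rV) + d)%R] = mu D.
Proof.
move=> mD; rewrite -[RHS](@muV_affine _ _ 1 d)// ?oner_eq0//.
rewrite normr1 expr1n mul1e; congr (mu _).
by apply/seteqP; split => x /=; rewrite scale1r.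
Qed.

Lemma translateE (X : set rV) (c x : rV) : translate X c x <-> X (x - c)%R.
Proof.
split; first by move=> [y Xy <-]; rewrite addrK.
by move=> h; exists (x - c)%R => //; rewrite subrK.
Qed.

Lemma conv_translate A B (a b : rV) z : measurable A -> measurable B ->
  conv (translate A a) (translate B b) z = conv A B ((z : rV) - (a + b))%R.
Proof.
move=> mA mB; rewrite /conv -[RHS](@muV_shift (- b)%R [set y : W | B y /\ A ((z : rV) - (a + b) - y)%R]); last first.
  exact: (@measurable_conv_set A B ((z : rV) - (a + b))%R).
have eqv (y : rV) : ((z : rV) - (a + b) - (y - b) = (z : rV) - y - a)%R.
  by rewrite opprB opprD !addrA subrK addrAC.
congr (mu _); apply/seteqP; split => y /=; rewrite eqv.
  by move=> [/translateE h1 /translateE h2].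
by move=> [h1 h2]; split; apply/translateE.
Qed.

Lemma ball0_exists (c : R) : (0 <= c)%R -> exists2 D : set W, ball0 D & mu D = c%:E.
Proof.
pose B (r : R) : set W := [set x | (enorm (x : rV) < r)%R].
have bB r : (0 <= r)%R -> ball0 (B r) by exists r => //; left.
have mB r : (0 <= r)%R -> measurable (B r) by move=> r0; apply: ball0_measurable; exact: bB.
have fB1 : mu (B 1%R) \is a fin_num.
  apply: (@bounded_fin _ _ _ 1%R) => //; first exact: mB.
  by move=> x; rewrite /B/= enorm_lt// => /ltW h i; exact: sumsq_coord.
set kap := fine (mu (B 1%R)).
have kapE : mu (B 1%R) = kap%:E by rewrite /kap fineK.
have kap0 : (0 < kap)%R.
  (* The box of side e = 1/(m+2) fits into the unit ball, since (m+1) e^2 < e < 1; hence the ball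
     has positive measure. *)
  rewrite -lte_fin -kapE; pose e : R := (m.+2%:R^-1)%R.
  have e0 : (0 < e)%R by rewrite invr_gt0.
  apply: (@lt_le_trans _ _ (mu (box 0%R (const_mx e)))).
    rewrite muV_box; last by move=> i; rewrite !mxE ltW.
    rewrite lte_fin; apply: prodr_gt0 => i _.
    by rewrite !mxE subr0.
  apply: le_mu; [exact: measurable_box|exact: mB|].
  move=> x h; rewrite /B/= enorm_lt// expr1n.
  apply: (@le_lt_trans _ _ (\sum_(i < m.+1) e ^+ 2)%R).
    apply: ler_sum => i _; have := h i; rewrite !mxE => /andP[h1 h2].
    by rewrite lerXn2r// nnegrE ltW.
  rewrite sumr_const card_ord -mulr_natl expr2 mulrA.
  have h1 : (m.+1%:R * e < 1)%R.
    by rewrite /e ltr_pdivrMr// mul1r ltr_nat.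
  have h2 : (e < 1)%R by rewrite /e invf_lt1// ltr1n.
  apply: lt_trans h2; rewrite -[ltRHS]mul1r ltr_pM2r//.
have muB r : (0 < r)%R -> mu (B r) = (r ^+ m.+1 * kap)%:E.
  move=> r0; rewrite -(@muV_affine _ _ r 0%R); [|by rewrite gt_eqF|exact: mB (ltW r0)].
  rewrite gtr0_norm// EFinM -kapE; congr (_ * mu _).
  apply/seteqP; split => x; rewrite /B/= addr0 !enorm_lt ?ltW// expr1n.
    rewrite (_ : sumsq _ = r ^+ 2 * sumsq (x : rV))%R; last first.
      by rewrite /sumsq mulr_sumr; apply: eq_bigr => i _; rewrite mxE exprMn.
    by rewrite -ltr_pdivlMl ?exprn_gt0// mulVf// gt_eqF// exprn_gt0.
  move=> h; rewrite (_ : sumsq _ = r ^+ 2 * sumsq (x : rV))%R; last first.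
    by rewrite /sumsq mulr_sumr; apply: eq_bigr => i _; rewrite mxE exprMn.
  by rewrite -ltr_pdivlMl ?exprn_gt0// mulVf// gt_eqF// exprn_gt0.
rewrite le_eqVlt => /predU1P[<-|c0].
  exists (B 0%R); first exact: bB.
  rewrite (_ : B 0%R = set0) ?measure0//; apply/seteqP; split => // x.
  by rewrite /B/= ltNge sqrtr_ge0.
pose r := ((c / kap) `^ m.+1%:R^-1)%R.
have r0 : (0 < r)%R by rewrite powR_gt0// divr_gt0.
exists (B r); first exact: bB (ltW r0).
rewrite muB// /r -powR_mulrn ?powR_ge0// -powRrM mulVf ?pnatr_eq0// powRr1 ?divr_ge0 ?ltW//.
by rewrite divfK// gt_eqF.
Qed.

Lemma mine_conv_le A B A' B' (t : R) :
  measurable A -> measurable B -> ball0 A' -> ball0 B' ->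
  mu A' = mu A -> mu B' = mu B -> mu A < +oo -> mu B < +oo -> (0 < t)%R ->
  \int[mu]_z mine (conv A' B' z) t%:E <= \int[mu]_z mine (conv A B z) t%:E.
Proof.
move=> mA mB bA' bB' AA' BB' Aoo Boo t0.
have mA' := ball0_measurable bA'; have mB' := ball0_measurable bB'.
pose C : set W := [set z | t%:E < conv A B z].
have mf := measurable_conv mA mB; have mf' := measurable_conv mA' mB'.
have mC : measurable C.
  by have := emeasurable_fun_o_infty measurableT mf t%:E; rewrite setTI.
have ABoo : mu A * mu B < +oo by rewrite lte_mul_pinfty// ge0_fin_numE.
(* Markov's inequality: C has finite measure, so a ball of the same measure exists. *)
have tC : t%:E * mu C <= mu A * mu B.
  rewrite -integral_conv// [X in _ * X]integralTE// -ge0_integralZl;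
    [|exact: measurableT|exact: measurable_indicE|by move=> z _; rewrite lee_fin|by rewrite lee_fin ltW].
  apply: integral_leT => z; first by rewrite mule_ge0// lee_fin// ltW.
  have [Cz|Cz] := pselect (C z); last by rewrite indicE memNset// mule0 conv_ge0.
  by rewrite indicE mem_set// mule1 ltW.
have fC : mu C \is a fin_num.
  rewrite ge0_fin_numE// ltey; apply/eqP => Coo; move: tC; rewrite Coo gt0_muley ?lte_fin//.
  by rewrite leye_eq => /eqP h; move: ABoo; rewrite h.
have [C' bC' CC'] := @ball0_exists (fine (mu C)) (fine_ge0 (measure_ge0 mu C)).
rewrite fineK// in CC'.
have mC' := ball0_measurable bC'.
have mmin (f : W -> \bar R) : measurable_fun setT f -> measurable_fun setT (fun z : W => mine (f z) t%:E).
  by move=> mg; exact: measurable_mine.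
have min0 (f : W -> \bar R) (z : W) : (forall z, 0 <= f z) -> 0 <= mine (f z) t%:E.
  by move=> f0; rewrite le_min f0 lee_fin ltW.
have mIf (D : set W) (f : W -> \bar R) : measurable D -> measurable_fun setT f ->
    measurable_fun setT (fun z : W => (\1_D z)%:E * f z : \bar R).
  by move=> mD mg; apply: emeasurable_funM => //; exact: measurable_indicE.
have If0 (D : set W) (f : W -> \bar R) z : (forall z, 0 <= f z) -> 0 <= (\1_D z)%:E * f z :> \bar R.
  by move=> f0; rewrite mule_ge0// lee_fin.
have tI (D : set W) : measurable D -> measurable_fun setT (fun z : W => t%:E * (\1_D z : R)%:E).
  by move=> mD; apply: measurable_funeM; exact: measurable_indicE.
have tI0 (D : set W) z : 0 <= t%:E * (\1_D z : R)%:E.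
  by rewrite mule_ge0// lee_fin// ltW.
have tIE (D : set W) : measurable D -> \int[mu]_z (t%:E * (\1_D z)%:E) = t%:E * mu D.
  move=> mD; rewrite ge0_integralZl;
    [|exact: measurableT|exact: measurable_indicE|by move=> z _; rewrite lee_fin|by rewrite lee_fin ltW].
  by rewrite integralTE.
(* Pointwise, min(f, t) + 1_C f = f + t 1_C when C = {f > t}; for any other C
   the left side is at most the right side. *)
have E1 : \int[mu]_z mine (conv A B z) t%:E + tri A B C = mu A * mu B + t%:E * mu C.
  rewrite tri_conv// -integral_conv// -tIE//.
  rewrite -ge0_integralD; [|exact: measurableT|by move=> z _; apply: min0 => ?; exact: conv_ge0|exact: mmin|by move=> z _; apply: If0 => ?; exact: conv_ge0|exact: mIf].
  rewrite -ge0_integralD; [|exact: measurableT|by move=> z _; exact: conv_ge0|exact: mf|by move=> z _|exact: tI].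
  apply: eq_integral => z _; have [Cz|Cz] := pselect (C z).
    by rewrite indicE mem_set// mul1e mule1 min_r ?ltW// addeC.
  by rewrite indicE memNset// mul0e mule0 !adde0 min_l// leNgt; apply/negP.
have E2 : \int[mu]_z mine (conv A' B' z) t%:E + tri A' B' C' <= mu A * mu B + t%:E * mu C.
  rewrite tri_conv// -AA' -BB' -integral_conv// -CC' -tIE//.
  rewrite -ge0_integralD; [|exact: measurableT|by move=> z _; apply: min0 => ?; exact: conv_ge0|exact: mmin|by move=> z _; apply: If0 => ?; exact: conv_ge0|exact: mIf].
  rewrite -ge0_integralD; [|exact: measurableT|by move=> z _; exact: conv_ge0|exact: mf'|by move=> z _|exact: tI].
  apply: integral_leT => z.
    by rewrite adde_ge0//; [apply: min0 => ?; exact: conv_ge0|apply: If0 => ?; exact: conv_ge0].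
  have [Cz|Cz] := pselect (C' z).
    by rewrite indicE mem_set// mul1e mule1 addeC leeD2l// ge_min lexx orbT.
  by rewrite indicE memNset// mul0e mule0 !adde0 ge_min lexx.
have RZ : tri A B C <= tri A' B' C' by apply: riesz; rewrite ?AA' ?BB' ?CC'.
have trile X Y D : measurable X -> measurable Y -> measurable D -> tri X Y D <= mu X * mu Y.
  move=> mX mY mD; rewrite (tri_conv mX mY mD) -(integral_conv mX mY); apply: integral_leT => z.
    by apply: If0 => ?; exact: conv_ge0.
  by rewrite indicE; case: (_ \in _); rewrite ?mul1e ?mul0e ?conv_ge0.
have tf' : tri A' B' C' \is a fin_num.
  rewrite ge0_fin_numE; last exact: measure_ge0.
  by apply: (le_lt_trans (trile _ _ _ mA' mB' mC')); rewrite AA' BB'.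
(* Adding the finite functional of the balls to both sides lets [E2], [E1] and Riesz' inequality be
   chained. *)
rewrite -(leeD2rE _ _ tf'); apply: (le_trans E2); rewrite -E1.
exact: leeD2l.
Qed.

End convolution.

(** * From truncated convolutions to 1 - (1 - p)^n *)

Section union_probability.
Local Open Scope ereal_scope.
Variable R : realType.
Local Notation lam := (@lebesgue_measure R).
Local Notation RM := (measurableTypeR R).

Lemma integral_deriv_poly (P : {poly R}) (a b : R) : (a <= b)%R ->
  \int[lam]_(x in `[a, b]) (P^`().[x])%:E = (P.[b] - P.[a])%:E.
Proof.
rewrite le_eqVlt => /predU1P[->|ab]; first by rewrite set_itv1 integral_set1 subrr.
rewrite (@continuous_FTC2 _ (horner P^`()) (horner P))//.
- by apply: continuous_subspaceT => x; exact: continuous_horner.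
- split; first by move=> x _; exact: derivable_horner.
    by apply: cvg_at_right_filter; exact: continuous_horner.
  by apply: cvg_at_left_filter; exact: continuous_horner.
- by move=> x _; rewrite derivE.
Qed.

(** For n = k + 2 this is, on [0, 1], minus the second derivative of phi(s) = 1 - (1 - s)^n. A
    concave phi with phi(0) = 0 and phi'(1) = 0 is the mixture of the functions min(., s) with this
    density. *)
Definition weight k (s : R) : R :=
  (\1_`[0%R, 1%R]%classic s * (k.+2%:R * k.+1%:R * (1 - s) ^+ k))%R.

Lemma weight_ge0 k s : (0 <= weight k s)%R.
Proof.
rewrite /weight indicE; have [|] := boolP (s \in _); last by rewrite mul0r.
rewrite inE/= in_itv/= => /andP[_ s1].
by rewrite !mulr_ge0// exprn_ge0// subr_ge0.
Qed.

Lemma measurable_weight k : measurable_fun setT (weight k : RM -> RM).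
Proof.
apply: measurable_funM; first exact: measurable_indic.
apply: measurable_funM => //; apply: measurable_funX; exact: measurable_funB.
Qed.

(* 1 - (1 - p)^n is a mixture of the functions p |-> min(p, s). *)
Lemma integral_weight_min k (p : R) : (0 <= p <= 1)%R ->
  \int[lam]_s (weight k s * Num.min p s)%:E = (1 - (1 - p) ^+ k.+2)%:E.
Proof.
move=> /andP[p0 p1].
pose c : R := (k.+2%:R * k.+1%:R)%R.
pose g (s : R) := (c * (1 - s) ^+ k * Num.min p s)%R.
have mg D : measurable_fun D (fun s : RM => (g s)%:E).
  apply: measurable_funTS; apply/measurable_EFinP; apply: measurable_funM; last exact: measurable_minr.
  by apply: measurable_funM => //; apply: measurable_funX; exact: measurable_funB.
transitivity (\int[lam]_(s in `[0%R, 1%R]) (g s)%:E).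
  rewrite [RHS]integral_mkcond; apply: eq_integral => s _; rewrite /weight indicE patchE.
  by case: ifPn => _; rewrite ?mul1r ?mul0r.
rewrite (@itv_bndbnd_setU _ _ (BLeft 0%R) (BRight p) (BRight 1%R))//.
rewrite ge0_integral_setU//; last 2 first.
- move=> s /=; rewrite !in_itv/= => s01; rewrite lee_fin /g.
  have {}s01 : (0 <= s <= 1)%R by case: s01 => /andP[h1 h2]; apply/andP; split; lra.
  move: s01 => /andP[s0 s1]; by rewrite !mulr_ge0 ?exprn_ge0 ?subr_ge0// le_min p0//.
- by apply/disj_setPRL => s /=; rewrite !in_itv/= => /andP[h1 h2] /andP[h3 h4]; lra.
rewrite integral_itv_obnd_cbnd; last exact: mg.
have dE n : ((1 - 'X : {poly R}) ^+ n.+1)^`() = (- (n.+1%:R *: (1 - 'X) ^+ n))%R.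
  by rewrite deriv_exp derivB derivX derivC sub0r mulN1r mulNrn scaler_nat.
(* Below p the minimum is s and integration by parts gives the antiderivative; above p it is the
   constant p. Both antiderivatives are polynomials, so only end-point values remain. *)
have -> : \int[lam]_(s in `[0%R, p]) (g s)%:E =
   \int[lam]_(s in `[0%R, p]) ((- (k.+2%:R *: ('X * (1 - 'X) ^+ k.+1) + (1 - 'X) ^+ k.+2) : {poly R})^`().[s])%:E.
  apply: eq_integral => s; rewrite inE/= in_itv/= => /andP[s0 sp].
  rewrite /g min_r// /c; congr EFin.
  rewrite derivN derivD derivZ derivM !dE derivX.
  rewrite !(hornerE, horner_exp) !exprS.
  by ring.
have -> : \int[lam]_(s in `[p, 1%R]) (g s)%:E =
   \int[lam]_(s in `[p, 1%R]) ((- (p * k.+2%:R *: (1 - 'X) ^+ k.+1) : {poly R})^`().[s])%:E.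
  apply: eq_integral => s; rewrite inE/= in_itv/= => /andP[s0 sp].
  rewrite /g min_l// /c; congr EFin.
  rewrite derivN derivZ dE !(hornerE, horner_exp).
  by ring.
rewrite !integral_deriv_poly// -EFinD; congr EFin.
rewrite !(hornerE, horner_exp)/= subrr !exprS.
by rewrite !subr0 !expr1n; ring.
Qed.

Variable m : nat.
Local Notation W := (borel_rV R m.+1).
Local Notation mu := (muV R m.+1).
Local Notation rV := 'rV[R]_m.+1.

(* The chance that a point y, uniform in B, has z in A + y. *)
Definition hit (A B : set W) (z : W) : R := (fine (conv A B z) / fine (mu B))%R.

Lemma hit_bounds (A B : set W) z : measurable A -> measurable B ->
  0 < mu B -> mu B < +oo -> (0 <= hit A B z <= 1)%R.
Proof.
move=> mA mB B0 Boo.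
have fB : mu B \is a fin_num by rewrite ge0_fin_numE.
have b0 : (0 < fine (mu B))%R by rewrite fine_gt0// B0.
have cB : conv A B z <= mu B by exact: conv_le.
have fc : conv A B z \is a fin_num by rewrite ge0_fin_numE// (le_lt_trans cB).
apply/andP; split; first by rewrite divr_ge0// ?fine_ge0// ltW.
by rewrite ler_pdivrMr// mul1r fine_le.
Qed.

Lemma measurable_hit (A B : set W) : measurable A -> measurable B ->
  measurable_fun setT (hit A B : W -> RM).
Proof.
move=> mA mB; apply: measurable_funM; last exact: measurable_cst.
exact: (measurableT_comp (@fine_measurable R setT measurableT) (measurable_conv mA mB)).
Qed.

Lemma integral_hit (A B : set W) : measurable A -> measurable B ->
  0 < mu B -> mu B < +oo -> \int[mu]_z (hit A B z)%:E = mu A.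
Proof.
move=> mA mB B0 Boo.
have fB : mu B \is a fin_num by rewrite ge0_fin_numE.
have b0 : (0 < fine (mu B))%R by rewrite fine_gt0// B0.
transitivity (\int[mu]_z ((fine (mu B))^-1%:E * conv A B z)).
  apply: eq_integral => z _; rewrite /hit mulrC EFinM fineK// ge0_fin_numE; last exact: conv_ge0.
  by apply: le_lt_trans Boo; exact: conv_le.
rewrite ge0_integralZl; [|exact: measurableT|exact: measurable_conv|by move=> z _; exact: conv_ge0|by rewrite lee_fin invr_ge0 ltW].
by rewrite integral_conv// -[X in mu A * X]fineK// muleCA -EFinM mulVf ?gt_eqF// mule1.
Qed.

Lemma integral_union_le n (A B A' B' : set W) :
  measurable A -> measurable B -> ball0 A' -> ball0 B' ->
  mu A' = mu A -> mu B' = mu B -> mu A < +oo -> 0 < mu B -> mu B < +oo ->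
  \int[mu]_z (1 - (1 - hit A' B' z) ^+ n)%:E <= \int[mu]_z (1 - (1 - hit A B z) ^+ n)%:E.
Proof.
move=> mA mB bA' bB' AA' BB' Aoo B0 Boo.
have mA' := ball0_measurable bA'; have mB' := ball0_measurable bB'.
have B'0 : 0 < mu B' by rewrite BB'.
have B'oo : mu B' < +oo by rewrite BB'.
have b0 : (0 < fine (mu B))%R by rewrite fine_gt0// B0.
(* For n = 1 the slope of 1 - (1 - p)^n at p = 1 is not 0 and the mixture formula fails, but both
   sides then equal the measure of A. *)
case: n => [|[|k]].
- by apply: integral_leT => z; rewrite !expr0 subrr.
- have E X Y : \int[mu]_z (1 - (1 - hit X Y z) ^+ 1)%:E = \int[mu]_z (hit X Y z)%:E.
    by apply: eq_integral => z _; rewrite expr1 opprB addrC subrK.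
  by rewrite !E !integral_hit// AA'.
pose f (X Y : set W) (z : W) (s : RM) : \bar R := (weight k s * Num.min (hit X Y z) s)%:E.
(* Equal to [f], as the weight vanishes for s < 0 and the minimum is 0 at s = 0; this form shows
   nonnegativity without the sign of s. *)
pose f0 (X Y : set W) (z : W) (s : RM) : \bar R :=
  (weight k s * (if (0 < s)%R then Num.min (hit X Y z) s else 0))%:E.
have min0 (X Y : set W) z s : measurable X -> measurable Y -> 0 < mu Y -> mu Y < +oo -> (0 < s)%R ->
    (0 <= Num.min (hit X Y z) s)%R.
  by move=> mX mY Y0 Yoo s0; rewrite le_min (ltW s0) andbT; have /andP[] := hit_bounds z mX mY Y0 Yoo.
have ff0 X Y z s : measurable X -> measurable Y -> 0 < mu Y -> mu Y < +oo -> f X Y z s = f0 X Y z s.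
  move=> mX mY Y0 Yoo; rewrite /f /f0; case: ltP => // s0; congr EFin.
  rewrite mulr0; move: s0; rewrite le_eqVlt => /predU1P[->|s0].
    by rewrite min_r ?mulr0//; have /andP[] := hit_bounds z mX mY Y0 Yoo.
  by rewrite /weight indicE memNset ?mul0r// /= in_itv/= => /andP[]; rewrite leNgt s0.
have f0_ge0 X Y z s : measurable X -> measurable Y -> 0 < mu Y -> mu Y < +oo -> 0 <= f0 X Y z s.
  move=> mX mY Y0 Yoo; rewrite lee_fin mulr_ge0 ?weight_ge0//.
  by case: ifPn => // s0; exact: min0.
have key X Y : measurable X -> measurable Y -> 0 < mu Y -> mu Y < +oo ->
    \int[mu]_z (1 - (1 - hit X Y z) ^+ k.+2)%:E = \int[lam]_s \int[mu]_z f0 X Y z s.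
  move=> mX mY Y0 Yoo.
  transitivity (\int[mu]_z \int[lam]_s f X Y z s).
    by apply: eq_integral => z _; rewrite integral_weight_min//; exact: hit_bounds.
  rewrite (@integral_swap _ _ W RM R mu lam (f X Y)); last 2 first.
  - apply/measurable_EFinP; apply: measurable_funM.
      exact: (measurableT_comp (measurable_weight k) measurable_snd).
    apply: measurable_minr; last exact: measurable_snd.
    exact: (measurableT_comp (measurable_hit mX mY) measurable_fst).
  - by move=> z s; rewrite ff0//; exact: f0_ge0.
  by apply: eq_integral => s _; apply: eq_integral => z _; exact: ff0.
rewrite (key A' B' mA' mB' B'0 B'oo) (key A B mA mB B0 Boo); apply: integral_leT => s.
  by apply: integral_ge0 => z _; exact: f0_ge0.
have [s0|s0] := ltP 0%R s; last first.
  rewrite integral0_eq => [|z _]; last by rewrite /f0 ltNge s0/= mulr0.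
  by rewrite integral0_eq// => z _; rewrite /f0 ltNge s0/= mulr0.
(* Scaling by the measure of B turns min([hit], s) into min([conv], s |B|), so that [mine_conv_le]
   applies with t = s |B|. *)
have E X Y : measurable X -> measurable Y -> mu Y = mu B ->
    \int[mu]_z f0 X Y z s =
    (weight k s / fine (mu B))%:E * \int[mu]_z mine (conv X Y z) (s * fine (mu B))%:E.
  move=> mX mY YB; rewrite -ge0_integralZl;
    [|exact: measurableT|by apply: measurable_mine => //; exact: measurable_conv| |]; last 2 first.
  - by move=> z _; rewrite le_min conv_ge0 lee_fin mulr_ge0// ltW.
  - by rewrite lee_fin divr_ge0 ?weight_ge0// ltW.
  apply: eq_integral => z _; rewrite /f0 s0 /hit YB.
  have fc : conv X Y z \is a fin_num.
    rewrite ge0_fin_numE; last exact: conv_ge0; apply: le_lt_trans Boo; rewrite -YB; exact: conv_le.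
  rewrite -[in RHS](fineK fc) -EFin_min -EFinM; congr EFin.
  rewrite -[RHS]mulrA; congr (_ * _)%R.
  rewrite minr_pMr ?invr_ge0 ?ltW//; congr Num.min; first exact: mulrC.
  by rewrite mulrC mulfK// gt_eqF.
rewrite (E A' B' mA' mB' BB') (E A B mA mB erefl); apply: lee_wpmul2l.
  by rewrite lee_fin divr_ge0 ?weight_ge0// ltW.
by apply: mine_conv_le => //; rewrite mulr_gt0.
Qed.

End union_probability.

(** * The expected measure of the union as an integral *)

Section expectation.
Local Open Scope ereal_scope.
Variables (R : realType) (m : nat).
Local Notation W := (borel_rV R m.+1).
Local Notation mu := (muV R m.+1).
Local Notation rV := 'rV[R]_m.+1.

Variables (dO : measure_display) (Omega : measurableType dO) (P : probability Omega R)
  (n : nat) (b : 'I_n -> {RV P >-> W}) (A B : set W).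
Hypotheses (mA : measurable A) (mB : measurable B) (B_gt0 : 0 < mu B) (B_fin : mu B < +oo)
  (indep_b : independent b)
  (law_b : forall i (E : set W), measurable E -> distribution P (b i) E = mu (E `&` B) / mu B).

Let reached (z : W) : set W := [set y : W | A ((z : rV) - y)%R].

Let measurable_reached z : measurable (reached z).
Proof. by apply: (@measurable_preT _ _ _ _ (fun y : W => ((z : rV) - y)%R : W)) => //; exact: measurable_subV. Qed.

Let prob_missed i z : P (b i @^-1` ~` reached z) = (1 - hit A B z)%:E.
Proof.
rewrite preimage_setC probability_setC; last first.
  exact: (measurable_funPTI (b i) (measurable_reached z)).
have -> : P (b i @^-1` reached z) = distribution P (b i) (reached z) by [].
rewrite law_b// EFinB; congr (_ - _).
have fB : mu B \is a fin_num by rewrite ge0_fin_numE.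
have b0 : (0 < fine (mu B))%R by rewrite fine_gt0// B_gt0.
have -> : mu (reached z `&` B) = conv A B z.
  by congr (mu _); apply/seteqP; split => y [].
have fc : conv A B z \is a fin_num.
  rewrite ge0_fin_numE; last exact: conv_ge0.
  by apply: le_lt_trans B_fin; exact: conv_le.
by rewrite -[X in X / _](fineK fc) -[X in _ / X](fineK fB) inver gt_eqF// -EFinM.
Qed.

Let prob_reached z : P [set w | exists i, A ((z : rV) - b i w)%R] = (1 - (1 - hit A B z) ^+ n)%:E.
Proof.
rewrite (_ : [set w | _] = ~` \bigcap_(i in [set` [set: 'I_n]%SET]) (b i @^-1` ~` reached z)); last first.
  apply/seteqP; split => [w [i Ai] h|w /= h]; first by apply: (h i) => //=; rewrite inE.
  by apply: contrapT => /forallNP h2; apply: h => i _ /= Ai; exact: (h2 i).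
rewrite probability_setC; last first.
  apply: fin_bigcap_measurable; first exact: finite_finset.
  by move=> i _; exact: (measurable_funPTI (b i) (measurableC (measurable_reached z))).
rewrite (indep_b (fun i _ => measurableC (measurable_reached z))) EFinB; congr (_ - _).
rewrite (eq_bigr (fun=> (1 - hit A B z)%:E)); last by move=> i _; exact: prob_missed.
by rewrite prodEFin prodr_const cardsT card_ord.
Qed.

Lemma expected_union :
  \int[P]_w lebS (\bigcup_i translate A (b i w)) = \int[mu]_z (1 - (1 - hit A B z) ^+ n)%:E.
Proof.
pose S : set (Omega * W) := [set p | exists i, A ((p.2 : rV) - b i p.1)%R].
have mS : measurable S.
  rewrite (_ : S = \bigcup_(i in [set: 'I_n]) ((fun p : Omega * W => ((p.2 : rV) - b i p.1)%R : W) @^-1` A)); last first.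
    by apply/seteqP; split => [p [i Ai]|p [i _ Ai]]; exists i.
  apply: fin_bigcup_measurable; first exact: finite_finset.
  move=> i _; apply: measurable_preT => //; apply: measurable_subV => //.
  by apply: (measurableT_comp _ measurable_fst); exact: measurable_funP.
have mI : measurable_fun setT (fun p : Omega * W => (\1_S p : R)%:E) by exact: measurable_indicE.
transitivity (\int[P]_w \int[mu]_z (\1_S (w, z) : R)%:E).
  apply: eq_integral => w _.
  have mU : measurable (xsection S w) by exact: measurable_xsection.
  have -> : \bigcup_i translate A (b i w) = xsection S w.
    apply/seteqP; split => z.
      by move=> [i _ /translateE Ai]; rewrite /xsection/= inE; exists i.
    by rewrite /xsection/= inE => -[i Ai]; exists i => //; exact/translateE.
  rewrite lebS_borel// integralTE//; apply: eq_integral => z _.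
  by rewrite !indicE mem_xsection.
rewrite (@integral_swap _ _ Omega W R P mu (fun w z => (\1_S (w, z))%:E)); last 2 first.
- by rewrite (_ : (fun p => _) = (fun p => (\1_S p)%:E))//; apply/funext => -[].
- by move=> w z; rewrite lee_fin.
apply: eq_integral => z _; rewrite -prob_reached integralTE.
  by apply: eq_integral => w _; rewrite !indicE; congr ((_ : bool)%:R)%:E; apply/idP/idP; rewrite !inE.
have := measurable_ysection z mS; congr measurable.
by apply/seteqP; split => w; rewrite /ysection/= inE.
Qed.

End expectation.

(** * Recentering the balls and passing to Borel sets *)

Section final.
Local Open Scope ereal_scope.
Variables (R : realType) (m : nat).
Local Notation W := (borel_rV R m.+1).
Local Notation mu := (muV R m.+1).
Local Notation rV := 'rV[R]_m.+1.

Lemma ball_translate (S : set W) : is_euclidean_ball S ->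
  exists (D : set W) (c : rV), ball0 D /\ S = translate D c.
Proof.
move=> [c [r [r0 SE]]].
have E (D : set W) : translate D c = [set x | D (x - c)%R].
  by apply/seteqP; split => x; rewrite translateE.
case: SE => ->.
- exists [set x : W | (enorm (x : rV) < r)%R], c; rewrite E.
  by split=> //; exists r; [exact: ltW|left].
- exists [set x : W | (enorm (x : rV) <= r)%R], c; rewrite E.
  by split=> //; exists r; [exact: ltW|right].
Qed.

Lemma measurable_translate (D : set W) (c : rV) : measurable D ->
  measurable (translate D c : set W).
Proof.
move=> mD; rewrite (_ : translate D c = (fun x : W => ((x : rV) - c)%R : W) @^-1` D).
  by apply: measurable_preT => //; exact: measurable_subV.
by apply/seteqP; split => x /translateE.
Qed.

Lemma muV_translate (D : set W) (c : rV) : measurable D -> mu (translate D c) = mu D.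
Proof.
move=> mD; rewrite -(@muV_shift _ _ (- c)%R D)//; congr (mu _).
by apply/seteqP; split => x /translateE.
Qed.

(** Translating A by a and B by b only shifts the chance of being hit by a + b, so the given balls
    may be recentered at 0. *)
Lemma integral_hit_translate n (A B : set W) (a b : rV) : measurable A -> measurable B ->
  0 < mu B -> mu B < +oo ->
  \int[mu]_z (1 - (1 - hit (translate A a) (translate B b) z) ^+ n)%:E =
  \int[mu]_z (1 - (1 - hit A B z) ^+ n)%:E.
Proof.
move=> mA mB B0 Boo.
rewrite -[RHS](@ge0_integral_muV_shift _ _ (- (a + b))%R (fun z => (1 - (1 - hit A B z) ^+ n)%:E)).
- by apply: eq_integral => z _; rewrite /hit conv_translate// muV_translate.
- apply/measurable_EFinP; apply: measurable_funB => //; apply: measurable_funX.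
  by apply: measurable_funB => //; exact: measurable_hit.
- move=> z; rewrite lee_fin subr_ge0; have /andP[h1 h2] := hit_bounds z mA mB B0 Boo.
  by rewrite exprn_ile1// ?subr_ge0// lerBlDr lerDl.
Qed.

(** Being uniform on B and being uniform on its Borel kernel are the same law. *)
Lemma lebS_setI_kernel (B B0 E : set W) : measurable E -> measurable B0 -> B0 `<=` B ->
  lebS (B `\` B0) = 0 -> lebS (E `&` B) = mu (E `&` B0).
Proof.
move=> mE mB0 B0B BB0; rewrite -lebS_borel; last exact: measurableI.
apply/eqP; rewrite eq_le; apply/andP; split; last by apply: le_lebS; exact: setIS.
rewrite -[leRHS]adde0 -BB0; apply: le_trans (outer_measureU2 (@lebS R m : {outer_measure set rV -> \bar R}) _ _).
apply: le_lebS => x [Ex Bx].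
by have [B0x|B0x] := pselect (B0 x); [left|right].
Qed.

End final.

Local Open Scope ereal_scope.

Theorem theorem1p1 (R : realType) (d n : nat) (hd : (0 < d)%N) (hn : (0 < n)%N)
  (A B A' B' : set 'rV[R]_d)
  (mA : lebesgue_measurable A) (mB : lebesgue_measurable B)
  (A_gt0 : 0 < leb A) (A_fin : leb A < +oo)
  (B_gt0 : 0 < leb B) (B_fin : leb B < +oo)
  (ballA' : is_euclidean_ball A') (ballB' : is_euclidean_ball B')
  (AA' : leb A' = leb A) (BB' : leb B' = leb B)
  (dO : measure_display) (Omega : measurableType dO) (P : probability Omega R)
  (b : 'I_n -> {RV P >-> borel_rV R d})
  (indep_b : independent b) (unif_b : forall i, uniform_on B (b i))
  (dO' : measure_display) (Omega' : measurableType dO')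
  (P' : probability Omega' R)
  (b' : 'I_n -> {RV P' >-> borel_rV R d})
  (indep_b' : independent b') (unif_b' : forall i, uniform_on B' (b' i)) :
  \int[P']_w leb (\bigcup_i translate A' (b' i w))
    <= \int[P]_w leb (\bigcup_i translate A (b i w)).
Proof.
case: d hd A B A' B' mA mB A_gt0 A_fin B_gt0 B_fin ballA' ballB' AA' BB' b indep_b unif_b b' indep_b' unif_b'
  => [//|m] _ A B A' B' mA mB A_gt0 A_fin B_gt0 B_fin ballA' ballB' AA' BB' b indep_b unif_b b' indep_b' unif_b'.
have [A0 [mA0 A0A AA0 A0E]] := borel_kernel mA A_fin.
have [B0 [mB0 B0B BB0 B0E]] := borel_kernel mB B_fin.
have [D [cA [bD A'E]]] := ball_translate ballA'.
have [F [cB [bF B'E]]] := ball_translate ballB'.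
have mD := ball0_measurable bD; have mF := ball0_measurable bF.
have mA' : measurable (A' : set (borel_rV R m.+1)) by rewrite A'E; exact: measurable_translate.
have mB' : measurable (B' : set (borel_rV R m.+1)) by rewrite B'E; exact: measurable_translate.
have DA : muV R m.+1 D = muV R m.+1 A0.
  by rewrite A0E -[RHS]AA' -(muV_translate cA mD) -A'E -lebS_borel.
have FB : muV R m.+1 F = muV R m.+1 B0.
  by rewrite B0E -[RHS]BB' -(muV_translate cB mF) -B'E -lebS_borel.
have B0_gt0 : 0 < muV R m.+1 B0 by rewrite B0E.
have B0_fin : muV R m.+1 B0 < +oo by rewrite B0E.
have muB' : muV R m.+1 B' = muV R m.+1 B0 by rewrite B'E muV_translate.
(* Shrinking A to its Borel kernel can only lower the larger side, so the union for A itself is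
   handled by monotonicity alone. *)
apply: (@le_trans _ _ (\int[P]_w lebS (\bigcup_i translate A0 (b i w)))); last first.
  apply: integral_leT => w; first exact: lebS_ge0.
  by apply: le_lebS => x [i _ [a Aa <-]]; exists i => //; exists a => //; exact: A0A.
rewrite (@expected_union _ _ _ _ _ _ b A0 B0)//; last first.
  move=> i E mE; rewrite (unif_b i E mE) B0E; congr (_ / _).
  exact: lebS_setI_kernel.
suff : \int[P']_w lebS (\bigcup_i translate A' (b' i w)) <=
  \int[muV R m.+1]_z (1 - (1 - hit A0 B0 z) ^+ n)%:E by [].
have B'_gt0 : 0 < muV R m.+1 B' by rewrite muB'.
have B'_fin : muV R m.+1 B' < +oo by rewrite muB'.
have law_b' i (E : set (borel_rV R m.+1)) : measurable E ->
    distribution P' (b' i) E = muV R m.+1 (E `&` B') / muV R m.+1 B'.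
  move=> mE; rewrite (unif_b' i E mE) BB' muB' B0E; congr (_ / _).
  by apply: lebS_borel; exact: measurableI.
rewrite (expected_union mA' mB' B'_gt0 B'_fin indep_b' law_b').
have F_gt0 : 0 < muV R m.+1 F by rewrite FB.
have F_fin : muV R m.+1 F < +oo by rewrite FB.
rewrite A'E B'E (integral_hit_translate n cA cB mD mF F_gt0 F_fin).
have A0_fin : muV R m.+1 A0 < +oo by rewrite A0E.
exact: (integral_union_le n mA0 mB0 bD bF DA FB A0_fin B0_gt0 B0_fin).
Qed.
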